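(* Let $d\ge1$, let $a_0,\ldots,a_d>0$ with $a=a_0+\cdots+a_d$ and let $k$ be a positive integer. Suppose that $X\sim\mathcal{D}(a_0,\ldots,a_d)$ and $B\sim\mathcal{B}_k(a_0,\ldots,a_d)$. Then for all $f=(f_0,\ldots,f_d)$ with $f_0,\ldots,f_d>0$, $$T_k(B)(f)=\frac{T_{a+k}(X)(f)}{T_a(X)(f)}.$$ In particular, if $X$, $B$ and $Y\sim\beta(k,a)$ are independent then $$X\sim(1-Y)X+YB .$$
   Context: $E_{d+1}$ is the set of $\lambda\in\mathbb{R}^{d+1}$ with $\lambda_i\ge0$ for $i=0,\ldots,d$ and $\lambda_0+\cdots+\lambda_d=1$; its vertices are the natural basis vectors $e_0,\ldots,e_d$. For a random variable $X$ valued in $E_{d+1}$ and $c>0$, $T_c(X)(f)=\mathbb{E}(\langle f,X\rangle^{-c})$ for $f$ with all coordinates positive, where $\langle f,x\rangle=\sum_{i=0}^df_ix_i$. $U\sim V$ between random variables means equality in distribution, and $U\sim\mu$ means that $U$ has law $\mu$. For $p,q>0$, $\beta(p,q)$ is the law on $(0,1)$ with density $\frac{\Gamma(p+q)}{\Gamma(p)\Gamma(q)}x^{p-1}(1-x)^{q-1}$. For $a_0,\ldots,a_d>0$, the Dirichlet distribution $\mathcal{D}(a_0,\ldots,a_d)$ is the law on $E_{d+1}$ of $X=(X_0,\ldots,X_d)$ with $X_0=1-X_1-\cdots-X_d$ such that $(X_1,\ldots,X_d)$ has density $\frac{\Gamma(a_0+\cdots+a_d)}{\Gamma(a_0)\cdots\Gamma(a_d)}(1-x_1-\cdots-x_d)^{a_0-1}x_1^{a_1-1}\cdots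 x_d^{a_d-1}$ on the set where $x_1,\ldots,x_d>0$ and $x_1+\cdots+x_d<1$. If $b_0,\ldots,b_d\ge0$ are not all zero and $T=\{i: b_i>0\}$, then $\mathcal{D}(b_0,\ldots,b_d)$ denotes the Dirichlet distribution with parameters $(b_i)_{i\in T}$ concentrated on the convex hull of $(e_i)_{i\in T}$ (the coordinates with index outside $T$ are $0$); if $T=\{i_0\}$ it is $\delta_{e_{i_0}}$. The quasi Bernoulli distribution of order $k$ is the probability on $E_{d+1}$ $$\mathcal{B}_k(a_0,\ldots,a_d)=\frac{k!}{(a)_k}\sum_{(b_0,\ldots,b_d)\in\mathbb{N}^{d+1};\ b_0+\cdots+b_d=k}\ \prod_{i=0}^d\frac{(a_i)_{b_i}}{b_i!}\ \mathcal{D}(b_0,\ldots,b_d),$$ where $a=a_0+\cdots+a_d$, $\mathbb{N}=\{0,1,2,\ldots\}$ and $(c)_0=1$, $(c)_{n+1}=(c)_n(c+n)$. *)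

(* Defs.v *)
From HB Require Import structures.
From mathcomp Require Import all_boot all_order all_algebra.
From mathcomp Require Import all_classical all_reals all_analysis.

Set Implicit Arguments.
Unset Strict Implicit.
Unset Printing Implicit Defensive.

Import Order.TTheory GRing.Theory Num.Theory.
Import numFieldNormedType.Exports.

Local Open Scope classical_set_scope.
Local Open Scope ring_scope.

Section lebesgue_tuple.
Context {R : realType}.

Definition cons_pair (n : nat) (p : R * n.-tuple R) : n.+1.-tuple R :=
  [tuple of p.1 :: p.2].

Lemma measurable_cons_pair (n : nat) :
  measurable_fun [set: R * n.-tuple R] (@cons_pair n).
Proof. exact: measurable_cons. Qed.

Section step.
Context (n : nat) (m : {sigma_finite_measure set (n.-tuple R) -> \bar R}).

Definition lebesgue_cons : set (n.+1.-tuple R) -> \bar R :=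
  pushforward (@lebesgue_measure R \x m)%E (@cons_pair n).

Let lebesgue_cons0 : lebesgue_cons set0 = 0%E.
Proof. by rewrite /lebesgue_cons /pushforward preimage_set0 measure0. Qed.

Let lebesgue_cons_ge0 A : (0 <= lebesgue_cons A)%E.
Proof. by rewrite /lebesgue_cons /pushforward measure_ge0. Qed.

Let lebesgue_cons_sigma_additive : semi_sigma_additive lebesgue_cons.
Proof.
move=> F mF tF mUF; rewrite /lebesgue_cons /pushforward preimage_bigcup.
apply: measure_semi_sigma_additive.
- by move=> i; rewrite -[X in measurable X]setTI; exact: measurable_cons_pair.
- apply/trivIsetP => /= i j _ _ ij; rewrite -preimage_setI.
  by move/trivIsetP : tF => /(_ _ _ _ _ ij) ->//; rewrite preimage_set0.
- by rewrite -preimage_bigcup -[X in measurable X]setTI; exact: measurable_cons_pair.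
Qed.

HB.instance Definition _ := isMeasure.Build _ _ _ lebesgue_cons
  lebesgue_cons0 lebesgue_cons_ge0 lebesgue_cons_sigma_additive.

Let lebesgue_cons_sigma_finite : sigma_finite setT lebesgue_cons.
Proof.
have [F FT Foo] : sigma_finite setT (@lebesgue_measure R \x m)%E.
  have /sigma_finiteP[F [TF ndF Foo]] := sigma_finiteT (@lebesgue_measure R).
  have /sigma_finiteP[G [TG ndG Goo]] := sigma_finiteT m.
  exists (fun k => F k `*` G k).
    rewrite -setXTT TF TG predeqE => -[x y]; split.
      move=> [/= [i _ Fix] [k _ Gky]]; exists (maxn i k) => //; split.
      - by move: x Fix; exact/subsetPset/ndF/leq_maxl.
      - by move: y Gky; exact/subsetPset/ndG/leq_maxr.
    by move=> [i _ []/= ? ?]; split; exists i.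
  move=> k; have [? ?] := Foo k; have [? ?] := Goo k.
  split; first exact: measurableX.
  by rewrite product_measure1E// lte_mul_pinfty// ge0_fin_numE.
pose u (t : n.+1.-tuple R) : R * n.-tuple R := (thead t, [tuple of behead t]).
have mu_ : measurable_fun [set: n.+1.-tuple R] u.
  apply/measurable_fun_pair; last exact: measurable_behead.
  exact: (measurable_tnth ord0).
have cK : cancel (@cons_pair n) u.
  by case=> x t; rewrite /u /cons_pair theadE; congr pair; apply: val_inj.
exists (fun k => u @^-1` F k).
  by rewrite -preimage_bigcup -FT preimage_setT.
move=> k; have [mFk Fkoo] := Foo k; split.
  by rewrite -[X in measurable X]setTI; exact: mu_.
rewrite /= /lebesgue_cons /pushforward -comp_preimage.
by rewrite (_ : u \o _ = id)//; apply/funext => p /=; rewrite cK.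
Qed.

HB.instance Definition _ := Measure_isSigmaFinite.Build _ _ _ lebesgue_cons
  lebesgue_cons_sigma_finite.

End step.

(* n-dimensional Lebesgue measure; for n = 0 it is the unit mass at the unique
   point. *)
Fixpoint lebesgue_tuple (n : nat) :
    {sigma_finite_measure set (n.-tuple R) -> \bar R} :=
  match n with
  | 0 => @dirac _ (0.-tuple R) [tuple] R
  | n'.+1 => @lebesgue_cons n' (lebesgue_tuple n')
  end.

Lemma measurable_box (n : nat) (A : 'I_n -> set R) :
  (forall i, measurable (A i)) ->
  measurable [set t : n.-tuple R | forall i, A i (tnth t i)].
Proof.
move=> mA; rewrite (_ : [set _ | _] = \bigcap_(i in [set: 'I_n])
    ((fun t : n.-tuple R => tnth t i) @^-1` A i)); last first.
  by apply/seteqP; split=> t /= h i; [move=> _|]; exact: h.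
apply: fin_bigcap_measurable => // i _.
by rewrite -[X in measurable X]setTI; exact: measurable_tnth.
Qed.

Lemma lebesgue_tuple_box (n : nat) (A : 'I_n -> set R) :
  (forall i, measurable (A i)) ->
  lebesgue_tuple n [set t | forall i, A i (tnth t i)] =
  (\prod_(i < n) lebesgue_measure (A i))%E.
Proof.
elim: n A => [|n IH] A mA.
  by rewrite big_ord0 /= diracE mem_set//=; case.
rewrite big_ord_recl -IH//= /lebesgue_cons /pushforward.
have mB := @measurable_box n (fun i => A (lift ord0 i)) (fun i => mA (lift ord0 i)).
rewrite -(product_measure1E (@lebesgue_measure R) (lebesgue_tuple n) (mA ord0) mB).
apply: (congr1 (@lebesgue_measure R \x lebesgue_tuple n)%E); apply/seteqP; split=> -[x t] /=.
  by move=> h; split=> [|i]; [have := h ord0|have := h (lift ord0 i)];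
    rewrite ?tnth0 ?tnthS.
by move=> [Ax At] i; case: (unliftP ord0 i) => [j|] ->; rewrite ?tnth0 ?tnthS.
Qed.

End lebesgue_tuple.

Section laws.
Context {R : realType}.

Definition Gamma (c : R) : R :=
  \int[@lebesgue_measure R]_(x in `]0, +oo[) (x `^ (c - 1) * expR (- x)).

Definition rising (c : R) (n : nat) : R := \prod_(i < n) (c + i%:R).

Definition beta_law (p q : R) (A : set R) : \bar R :=
  (\int[@lebesgue_measure R]_(x in A `&` `]0%R, 1%R[)
    (Gamma (p + q) / (Gamma p * Gamma q)
       * x `^ (p - 1) * (1 - x) `^ (q - 1))%:E)%E.

(* E_{d+1} *)
Definition simplex (d : nat) : set (d.+1.-tuple R) :=
  [set x | (forall i, 0 <= tnth x i) /\ \sum_(i < d.+1) tnth x i = 1].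

Definition vertex (d : nat) (i : 'I_d.+1) : d.+1.-tuple R :=
  [tuple (j == i)%:R | j < d.+1].

Definition open_corner (d : nat) : set (d.-tuple R) :=
  [set x | (forall i, 0 < tnth x i) /\ \sum_(i < d) tnth x i < 1].

Definition dirichlet_pdf (d : nat) (a : 'I_d.+1 -> R) (x : d.-tuple R) : R :=
  Gamma (\sum_(i < d.+1) a i) / (\prod_(i < d.+1) Gamma (a i))
    * (1 - \sum_(i < d) tnth x i) `^ (a ord0 - 1)
    * \prod_(i < d) (tnth x i) `^ (a (lift ord0 i) - 1).

Definition complete_coord (d : nat) (x : d.-tuple R) : d.+1.-tuple R :=
  [tuple of (1 - \sum_(i < d) tnth x i) :: x].

(* Law of (1 - X_1 - ... - X_d, X_1, ..., X_d); meant for a i > 0. *)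
Definition dirichlet (d : nat) (a : 'I_d.+1 -> R) :
    set (d.+1.-tuple R) -> \bar R :=
  fun A => (\int[lebesgue_tuple d]_(x in @open_corner d `&`
     @complete_coord d @^-1` A) (dirichlet_pdf a x)%:E)%E.

(* Places the j-th coordinate of y at index (nth s j); the coordinates whose
   index is not in s are 0. *)
Definition face_embed (d m : nat) (s : seq 'I_d.+1) (y : m.-tuple R) :
    d.+1.-tuple R :=
  [tuple nth 0 y (index i s) | i < d.+1].

(* D(b) for b i >= 0 not all zero. The value for b = 0 is junk. *)
Definition dirichlet_face (d : nat) (b : 'I_d.+1 -> R) :
    set (d.+1.-tuple R) -> \bar R :=
  match [seq i <- enum 'I_d.+1 | 0 < b i] with
  | [::] => fun=> 0%E
  | [:: i0] => @dirac _ (d.+1.-tuple R) (vertex i0) R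
  | (i0 :: s') as s =>
      pushforward
        (dirichlet (fun j : 'I_(size s').+1 => b (nth i0 s j)))
        (face_embed s)
  end.

Definition quasi_bernoulli (d k : nat) (a : 'I_d.+1 -> R) :
    set (d.+1.-tuple R) -> \bar R :=
  fun A =>
  ((k`!%:R / rising (\sum_(i < d.+1) a i) k)%:E *
   \sum_(b : {ffun 'I_d.+1 -> 'I_k.+1} | (\sum_(i < d.+1) b i == k)%N)
     (\prod_(i < d.+1) (rising (a i) (b i) / (b i)`!%:R))%:E *
     dirichlet_face (fun i => (b i)%:R) A)%E.

End laws.

Section random.
Context {d0 d1 : measure_display} {Omega : measurableType d0}
  {V : measurableType d1} {R : realType} (P : probability Omega R).

Definition has_law (X : Omega -> V) (m : set V -> \bar R) : Prop :=
  forall A : set V, measurable A -> P (X @^-1` A) = m A.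

Definition eq_in_law (X Y : Omega -> V) : Prop :=
  forall A : set V, measurable A -> P (X @^-1` A) = P (Y @^-1` A).

End random.

(* Mutual independence: taking some A_i = setT gives the pairwise product rules. *)
Definition independent3 {d0 d1 d2 d3 : measure_display}
    {Omega : measurableType d0} {V1 : measurableType d1}
    {V2 : measurableType d2} {V3 : measurableType d3} {R : realType}
    (P : probability Omega R)
    (X1 : Omega -> V1) (X2 : Omega -> V2) (X3 : Omega -> V3) : Prop :=
  forall (A1 : set V1) (A2 : set V2) (A3 : set V3),
    measurable A1 -> measurable A2 -> measurable A3 ->
    P (X1 @^-1` A1 `&` X2 @^-1` A2 `&` X3 @^-1` A3) =
    (P (X1 @^-1` A1) * P (X2 @^-1` A2) * P (X3 @^-1` A3))%E.

(* The base of the power is positive as soon as f > 0 and X takes values in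
   simplex; outside of that case 0 `^ (- c) is 0, not +oo. *)
Definition T_ {d0 : measure_display} {Omega : measurableType d0}
    {R : realType} (P : probability Omega R) (d : nat) (c : R)
    (X : Omega -> d.+1.-tuple R) (f : 'I_d.+1 -> R) : \bar R :=
  'E_P[fun w => (\sum_(i < d.+1) f i * tnth (X w) i) `^ (- c)].

Definition mix {R : realType} (d : nat) (y : R) (x b : d.+1.-tuple R) :
    d.+1.-tuple R :=
  [tuple (1 - y) * tnth x i + y * tnth b i | i < d.+1].

(* Main.v *)
(* Let G be a vector of independent gamma variables of parameters b (a coordinate with
   b i = 0 being 0). Its total mass |G| and its direction G / |G| are independent, and the
   direction has law D(b); this holds on every face of the simplex. Consequences:
   - adding independent vectors of parameters a and b gives the mixture identity
     (1 - Y) D(a) + Y D(b) ~ D(a + b) for an independent Y ~ beta(|b|, |a|);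
   - the Laplace transform of G gives E <f, D(b)>^(-|b|) = prod_i f_i^(- b_i);
   - comparing densities, the multinomial theorem says that D(a) is the mixture of the
     D(a + b), |b| = k, with the same weights as the D(b) in B_k(a).
   Averaging the first two facts over b with these weights gives both claims; in
   particular no uniqueness theorem for the transforms T_c is needed. *)

Require Import Defs.
From HB Require Import structures.
From mathcomp Require Import all_boot all_order all_algebra.
From mathcomp Require Import all_classical all_reals all_analysis.
From mathcomp Require Import measurable_realfun ring lra.

Set Implicit Arguments.
Unset Strict Implicit.
Unset Printing Implicit Defensive.

Import Order.TTheory GRing.Theory Num.Theory.
Import numFieldNormedType.Exports.

Local Open Scope classical_set_scope.
Local Open Scope ring_scope.

(** The condition |b| = k is what lets one average over [b]. The power <f, .>^(-c) integrates to a
    product under a Dirichlet law when c is its total parameter. At c = a + k this fails for D(a)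
    itself, but holds for every term of its expansion into the D(a + b). Likewise the beta variable
    produced by adding vectors of parameters a and b depends on [b] only through |b| = k, so a
    single Y serves all terms. The obstacle is that D(b) has no density when some b_i vanish.
    Dirichlet laws are therefore handled as directions of gamma vectors. Densities enter only for
    positive parameters, and the general case follows by deleting the null coordinates. The beta law
    is the two-coordinate Dirichlet law, so one polar decomposition yields it too. Laws are compared
    through integrals of nonnegative extended-valued functions, so Tonelli and linearity apply
    without integrability conditions. *)

(** * Measures given by a density *)

Section density_measure.
Local Open Scope ereal_scope.
Context d (T : measurableType d) (R : realType) (mu : {measure set T -> \bar R}).
Context (p : T -> R) (mp : measurable_fun setT p) (p0 : forall x, (0 <= p x)%R).

(** The proofs are arguments so that the measure instance below can be inferred from the term
    itself. *)
Definition density_measure of measurable_fun setT p & (forall x, 0 <= p x)%R :=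
  fun A : set T => \int[mu]_(x in A) (p x)%:E.

Local Notation dens := (density_measure mp p0).

Let dens0 : dens set0 = 0.
Proof. exact: integral_set0. Qed.

Let dens_ge0 A : 0 <= dens A.
Proof. by apply: integral_ge0 => x _; rewrite lee_fin. Qed.

Let dens_sigma_additive : semi_sigma_additive dens.
Proof.
move=> F mF tF mUF; rewrite /density_measure ge0_integral_bigcup//.
- apply: is_cvg_ereal_nneg_natsum_cond => n _ _.
  by apply: integral_ge0 => x _; rewrite lee_fin.
- by apply/measurable_EFinP; exact: measurable_funTS.
- by move=> x _; rewrite lee_fin.
Qed.

HB.instance Definition _ := isMeasure.Build _ _ _ dens
  dens0 dens_ge0 dens_sigma_additive.

Import HBNNSimple.

(** By monotone convergence along simple functions increasing to [f]; for a simple function, both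
    sides are the same sum over level sets. *)
Lemma ge0_integral_density (f : T -> \bar R) :
  measurable_fun setT f -> (forall x, 0 <= f x) ->
  \int[dens]_x f x = \int[mu]_x (f x * (p x)%:E).
Proof.
move=> mf f0; pose h := nnsfun_approx measurableT mf.
have mpE : measurable_fun setT (EFin \o p) by exact/measurable_EFinP.
have pE0 x : 0 <= (p x)%:E by rewrite lee_fin.
have mh n : measurable_fun setT (EFin \o h n).
  by apply/measurable_EFinP; exact/measurable_funP.
have h0 n x : 0 <= (h n x)%:E by rewrite lee_fin.
have ndh x : {homo (fun n => (h n x)%:E) : a b / (a <= b)%N >-> a <= b}.
  by move=> a b ab; rewrite lee_fin; exact/lefP/nd_nnsfun_approx.
have fE x : f x = lim ((h n x)%:E @[n --> \oo]).
  by apply/esym/cvg_lim => //; apply: cvg_nnsfun_approx.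
have -> : \int[dens]_x f x = lim (\int[dens]_x (h n x)%:E @[n --> \oo]).
  by under eq_integral do rewrite fE; exact: monotone_convergence.
have fpE x : f x * (p x)%:E = lim (((h n x)%:E * (p x)%:E) @[n --> \oo]).
  apply/esym/cvg_lim => //; apply: cvgeZr => //.
  by apply: cvg_nnsfun_approx.
have -> : \int[mu]_x (f x * (p x)%:E) =
    lim (\int[mu]_x ((h n x)%:E * (p x)%:E) @[n --> \oo]).
  under eq_integral do rewrite fpE.
  apply: monotone_convergence => //.
  - by move=> n; apply: emeasurable_funM => //; exact: mh.
  - by move=> n x _; rewrite mule_ge0.
  - by move=> x _ a b ab; apply: lee_wpmul2r => //; exact: ndh.
apply: (congr1 (fun u : (\bar R)^nat => limn u)); apply/funext => n.
rewrite integralT_nnsfun sintegralE.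
transitivity (\int[mu]_x (\sum_(y \in range (h n))
    (y%:E * (\1_(h n @^-1` [set y]) x * p x)%:E))).
  rewrite ge0_integral_fsum//; last first.
  (* The side condition ranges over all real [y]; a level set of the nonnegative [h n] at [y < 0] is
     empty. *)
  - move=> y x _; case: (ltP y 0%R) => y0.
      by rewrite preimage_nnfun0// indicE in_set0 mul0r mule0.
    by rewrite -EFinM lee_fin !mulr_ge0.
  - by move=> y; apply/measurable_EFinP/measurable_funM => //; apply: measurable_funM.
  apply: eq_fsbigr => y _; case: (ltP y 0%R) => y0.
    rewrite preimage_nnfun0// measure0 mule0 integral0_eq// => x _.
    by rewrite indicE in_set0 mul0r mule0.
  rewrite ge0_integralZl//; last 2 first.
  - by apply/measurable_EFinP; apply: measurable_funM.
  - by move=> x _; rewrite lee_fin mulr_ge0.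
  congr (_ * _); rewrite [LHS]integral_mkcond; apply: eq_integral => x _.
  by rewrite patchE indicE; case: ifP; rewrite ?mul1r ?mul0r.
apply: eq_integral => x _; rewrite (fimfunE (h n)) -fsumEFin//.
rewrite ge0_mule_fsuml; last by move=> r; rewrite nnfun_muleindic_ge0.
by apply: eq_fsbigr => r _; rewrite -!EFinM mulrA.
Qed.

End density_measure.

(** * Tonelli for curried functions *)

Section iterated_integrals.
Local Open Scope ereal_scope.
Context d1 d2 (T1 : measurableType d1) (T2 : measurableType d2) (R : realType).
Context (m1 : {sigma_finite_measure set T1 -> \bar R})
        (m2 : {sigma_finite_measure set T2 -> \bar R}) (f : T1 -> T2 -> \bar R).
Hypotheses (mf : measurable_fun setT (fun p : T1 * T2 => f p.1 p.2))
           (f0 : forall x y, 0 <= f x y).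

Lemma measurable_fun_ge0_integral : measurable_fun setT (fun x => \int[m2]_y f x y).
Proof.
exact: (measurable_fun_fubini_tonelli_F (m2 := m2) (fun p : T1 * T2 => f p.1 p.2)).
Qed.

Lemma ge0_integral_swap :
  \int[m1]_x \int[m2]_y f x y = \int[m2]_y \int[m1]_x f x y.
Proof.
exact: (@fubini_tonelli _ _ _ _ _ m1 m2 (fun p : T1 * T2 => f p.1 p.2)).
Qed.

Lemma ge0_integral_prod :
  \int[m1 \x m2]_p f p.1 p.2 = \int[m1]_x \int[m2]_y f x y.
Proof.
by rewrite (@fubini_tonelli1 _ _ _ _ _ m1 m2 (fun p : T1 * T2 => f p.1 p.2)).
Qed.

End iterated_integrals.

(** * Translations and dilations of the line *)

Section lebesgue_affine.
Local Open Scope ereal_scope.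
Context {R : realType}.
Local Notation mu := (@lebesgue_measure R).

(** The image of Lebesgue measure under a translation gives every half-open interval its length,
    which characterizes Lebesgue measure. *)
Lemma ge0_integral_shift (c : R) (f : R -> \bar R) :
  measurable_fun setT f -> (forall x, 0 <= f x) ->
  \int[mu]_x f (x + c)%R = \int[mu]_x f x.
Proof.
move=> mf f0.
have mphi : measurable_fun (setT : set (measurableTypeR R))
    (fun x => (x + c)%R : measurableTypeR R).
  exact: measurable_funD.
transitivity
  (\int[pushforward mu (fun x : measurableTypeR R => (x + c)%R : measurableTypeR R)]_x f x).
  by rewrite ge0_integral_pushforward.
apply: eq_measure_integral => A mA _.
pose phi : {mfun measurableTypeR R >-> measurableTypeR R} :=
  HB.pack (fun x : measurableTypeR R => (x + c)%R : measurableTypeR R)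
    (isMeasurableFun.Build _ _ _ _ _ mphi).
apply: esym; apply: (@lebesgue_measure_unique R (pushforward mu phi)) => //.
move=> _ [[a b]] _ <- /=; rewrite /pushforward.
rewrite (_ : _ @^-1` _ = [set` `]a - c, b - c]%R]); last first.
  by apply/seteqP; split => x /=; rewrite !in_itv/= ltrBlDr lerBrDr.
rewrite !lebesgue_measure_itv/= !lte_fin; case: ltP => ab.
  by rewrite ltrD2r ab; congr EFin; lra.
by rewrite ltrD2r ltNge ab.
Qed.

(** Under x -> c x, the image of Lebesgue measure gives ]a, b] the mass (b - a) / c; multiplying by
    [c] restores the length, and uniqueness concludes. *)
Lemma ge0_integral_scale (c : R) (f : R -> \bar R) : (0 < c)%R ->
  measurable_fun setT f -> (forall x, 0 <= f x) ->
  \int[mu]_x f x = c%:E * \int[mu]_x f (c * x)%R.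
Proof.
move=> c0 mf f0.
have mphi : measurable_fun (setT : set (measurableTypeR R))
    (fun x => (c * x)%R : measurableTypeR R).
  exact: measurable_funM.
transitivity (c%:E *
    \int[pushforward mu (fun x : measurableTypeR R => (c * x)%R : measurableTypeR R)]_x f x);
  last first.
  by rewrite ge0_integral_pushforward.
pose phi : {mfun measurableTypeR R >-> measurableTypeR R} :=
  HB.pack (fun x : measurableTypeR R => (c * x)%R : measurableTypeR R)
    (isMeasurableFun.Build _ _ _ _ _ mphi).
pose k : {nonneg R} := NngNum (ltW c0).
rewrite -(ge0_integral_mscale (pushforward mu phi) measurableT k)//.
apply: eq_measure_integral => A mA _.
apply: (@lebesgue_measure_unique R (mscale k (pushforward mu phi))) => //.
move=> _ [[a b]] _ <- /=; rewrite /mscale/= /pushforward.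
rewrite (_ : _ @^-1` _ = [set` `]a / c, b / c]%R]); last first.
  by apply/seteqP; split => x /=; rewrite !in_itv/= ltr_pdivrMr// ler_pdivlMr// mulrC.
rewrite !lebesgue_measure_itv/= !lte_fin ltr_pM2r ?invr_gt0//; case: ltP => ab.
  by rewrite -EFinM; congr EFin; field; rewrite gt_eqF.
by rewrite mule0.
Qed.

End lebesgue_affine.
(** * The gamma function *)

Section gamma_function.
Context {R : realType}.
Local Notation mu := (@lebesgue_measure R).

(** Extended by 0 to the whole line, so that the affine changes of variables above apply
    directly. *)
Definition gamma_weight (c x : R) : R :=
  if 0 < x then x `^ (c - 1) * expR (- x) else 0.

Lemma gamma_weight_ge0 c x : 0 <= gamma_weight c x.
Proof. by rewrite /gamma_weight; case: ifP => // _; rewrite mulr_ge0 ?powR_ge0 ?expR_ge0. Qed.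

Lemma measurable_gamma_weight c : measurable_fun setT (gamma_weight c).
Proof.
apply: measurable_fun_if => //=.
- exact: measurable_fun_ltr.
- apply: measurable_funTS; apply: measurable_funM.
    exact: measurable_powR.
  by apply: measurableT_comp => //; exact: measurableT_comp.
Qed.

Lemma integral_gamma_weight_ge0 (c : R) : (0 <= \int[mu]_x (gamma_weight c x)%:E)%E.
Proof. by apply: integral_ge0 => x _; rewrite lee_fin gamma_weight_ge0. Qed.

Lemma GammaE (c : R) : Gamma c = fine (\int[mu]_x (gamma_weight c x)%:E).
Proof.
rewrite /Gamma /Rintegral; congr fine; rewrite integral_mkcond.
apply: eq_integral => x _; rewrite patchE /gamma_weight mem_setE in_itv/= andbT.
by case: ifP.
Qed.

(** Tilting by [l - 1] completes the factor exp(-x) of the weight to exp(-l x); then substitute x /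
    l. The identity lives in [0, +oo], so it is available before finiteness of the gamma
    integral. *)
Lemma integral_gamma_weight_laplace (c l : R) : 0 < l ->
  (\int[mu]_x (gamma_weight c x * expR (- ((l - 1) * x)))%:E
   = (l `^ (- c))%:E * \int[mu]_x (gamma_weight c x)%:E)%E.
Proof.
move=> l0; rewrite (@ge0_integral_scale _ l^-1) ?invr_gt0//; last 2 first.
- apply/measurable_EFinP; apply: measurable_funM.
    exact: measurable_gamma_weight.
  by do 2 apply: measurableT_comp => //; apply: measurable_funM.
- by move=> x; rewrite lee_fin mulr_ge0 ?gamma_weight_ge0 ?expR_ge0.
rewrite -!ge0_integralZl//; last 6 first.
- by apply/measurable_EFinP; exact: measurable_gamma_weight.
- by move=> x _; rewrite lee_fin gamma_weight_ge0.
- by rewrite lee_fin powR_ge0.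
- apply/measurable_EFinP; apply: measurable_funM.
    apply: (measurableT_comp (measurable_gamma_weight c)).
    by apply: measurable_funM.
  by do 2 apply: measurableT_comp => //; apply: measurable_funM => //; exact: measurable_funM.
- by move=> x _; rewrite lee_fin mulr_ge0 ?gamma_weight_ge0 ?expR_ge0.
- by rewrite lee_fin invr_ge0 ltW.
apply: eq_integral => x _; rewrite -!EFinM; congr EFin.
rewrite /gamma_weight pmulr_rgt0 ?invr_gt0//; case: ifP => x0; last by rewrite mul0r !mulr0.
have lc : l^-1 * l^-1 `^ (c - 1) = l `^ (- c).
  rewrite -powR_inv1 ?ltW// -powRrM -powRD ?(gt_eqF l0) ?implybT//.
  by congr (l `^ _); ring.
have le : expR (- (l^-1 * x)) * expR (- ((l - 1) * (l^-1 * x))) = expR (- x).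
  by rewrite -expRD; congr expR; field; rewrite gt_eqF.
rewrite powRM ?invr_ge0 ?ltW// -lc -le; ring.
Qed.


Lemma integral_itv1y (f F : R -> R) (l : R) :
  (forall x : R, 1 <= x -> 0 <= f x) ->
  (forall x : R, 0 < x -> {for x, continuous f}) ->
  (forall x : R, 0 < x -> is_derive x 1 F (f x)) -> F x @[x --> +oo] --> l ->
  (\int[mu]_(x in `[1%R, +oo[) (f x)%:E = (l - F 1)%:E)%E.
Proof.
move=> f0 cf dF Fl.
have dF1 x : 0 < x -> derivable F x 1 by move=> /dF[].
rewrite (@ge0_continuous_FTC2y R f F 1 l)//.
- apply/continuous_within_itvcyP; split.
    by move=> x; rewrite in_itv/= andbT => x1; apply: cf; exact: lt_trans x1.
  by apply: cvg_at_right_filter; exact: cf.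
- by move=> x x1; apply: dF1; exact: lt_trans x1.
- apply: cvg_at_right_filter.
  by apply: differentiable_continuous; apply/derivable1_diffP; exact: dF1.
- move=> x; rewrite in_itv/= andbT => x1.
  by rewrite derive1E; apply: derive_val; apply: dF; exact: lt_trans x1.
Qed.

Lemma integral_expR_itv1y (x : R) : 0 < x ->
  (\int[mu]_(l in `[1%R, +oo[) (expR (- ((l - 1) * x)))%:E = x^-1%:E)%E.
Proof.
move=> x0.
pose F (l : R) := - x^-1 * expR (- ((l - 1) * x)).
transitivity ((0 - F 1)%:E); last first.
  by congr EFin; rewrite /F subrr mul0r oppr0 expR0; ring.
apply: integral_itv1y.
- by move=> l _; exact: expR_ge0.
- move=> l _; apply: continuous_comp; last exact: continuous_expR.
  apply: (@continuousN _ R^o); apply: (@continuousM R R^o) => /=; last exact: cst_continuous.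
  by apply: (@continuousB _ R^o) => //=; exact: cst_continuous.
- move=> l _; apply: is_derive_eq.
  by rewrite /GRing.scale/=; field; rewrite gt_eqF.
- rewrite -(mulr0 (- x^-1)); apply: cvgMr.
  apply: (@cvg_comp _ _ _ (fun l => (l - 1) * x) (fun z => expR (- z)) _ (pinfty_nbhs R));
    last exact: cvgr_expR.
  apply/cvgryPge => A; near=> l.
  rewrite -ler_pdivrMr// lerBrDr; near: l; by apply: nbhs_pinfty_ge; exact: num_real.
Unshelve. all: by end_near. Qed.

Lemma powRN_cvg0 (c : R) : 0 < c -> x `^ (- c) @[x --> +oo] --> (0 : R).
Proof.
move=> c0; apply/cvgrPdist_lt => e e0; near=> x.
(* This threshold is the solution x of x^(-c) = e. *)
have ec0 : 0 < e `^ (- c^-1) by exact: powR_gt0.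
have xe : e `^ (- c^-1) < x by near: x; by apply: nbhs_pinfty_gt; exact: num_real.
have x0 : 0 < x by exact: lt_trans xe.
rewrite sub0r normrN ger0_norm ?powR_ge0// powRN invf_plt ?posrE ?powR_gt0//.
have -> : e^-1 = (e `^ (- c^-1)) `^ c.
  by rewrite -powRrM mulNr mulVf ?gt_eqF// powR_inv1// ltW.
by apply: gt0_ltr_powR => //; rewrite ?nnegrE ltW.
Unshelve. all: by end_near. Qed.

Lemma integral_powR_itv1y (c : R) : 0 < c ->
  (\int[mu]_(l in `[1%R, +oo[) (l `^ (- (c + 1)))%:E = c^-1%:E)%E.
Proof.
move=> c0.
pose F (l : R) := - c^-1 * l `^ (- c).
transitivity ((0 - F 1)%:E); last by congr EFin; rewrite /F powR1; ring.
apply: integral_itv1y.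
- by move=> l _; exact: powR_ge0.
- move=> l l0; apply: differentiable_continuous; apply/derivable1_diffP.
  by apply: derivable_powR; rewrite in_itv/= andbT.
- move=> l l0; have := is_derive1_powR (- c) l0 => dl.
  have := is_deriveZ (- c^-1) dl; rewrite (_ : _ *: _ = l `^ (- (c + 1)))//.
  by rewrite /GRing.scale/= opprD; field; rewrite gt_eqF.
- rewrite -[X in _ --> X](mulr0 (- c^-1)); apply: cvgMr; exact: powRN_cvg0.
Qed.

(* Integrating the scaling identity int x^c exp(-l x) dx = l^(-c-1) Gamma(c+1) over
   l >= 1 gives the functional equation, in [0, +oo] and without integration by parts
   at the singularity 0. *)
Lemma integral_gamma_weightS (c : R) : 0 < c ->
  (\int[mu]_x (gamma_weight (c + 1) x)%:E = c%:E * \int[mu]_x (gamma_weight c x)%:E)%E.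
Proof.
move=> c0.
(* The indicator of [1, +oo) becomes a factor of the integrand, so Tonelli runs over the whole line
   in both variables. *)
pose u (l : R) : R := if 1 <= l then 1 else 0.
have u0 l : 0 <= u l by rewrite /u; case: ifP.
have mu_ : measurable_fun setT u.
  by apply: measurable_fun_if => //; exact: measurable_fun_ler.
have uE (f : R -> R) :
    (\int[mu]_(l in `[1%R, +oo[) (f l)%:E = \int[mu]_l (u l * f l)%:E)%E.
  rewrite integral_mkcond; apply: eq_integral => l _.
  rewrite patchE mem_setE in_itv/= andbT /u.
  by case: ifP; rewrite ?mul1r ?mul0r.
have mwe (l : R) : measurable_fun setT
    (fun x => gamma_weight (c + 1) x * expR (- ((l - 1) * x))).
  apply: measurable_funM; first exact: measurable_gamma_weight.
  by do 2 apply: measurableT_comp => //; apply: measurable_funM.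
pose f (x l : R) := (u l * (gamma_weight (c + 1) x * expR (- ((l - 1) * x))))%:E.
have f0 x l : (0 <= f x l)%E.
  by rewrite lee_fin !mulr_ge0 ?gamma_weight_ge0 ?expR_ge0.
have mf : measurable_fun setT (fun p : R * R => f p.1 p.2).
  apply/measurable_EFinP; apply: measurable_funM; first exact: measurableT_comp.
  apply: measurable_funM.
    by apply: measurableT_comp => //; exact: measurable_gamma_weight.
  do 2 apply: measurableT_comp => //; apply: measurable_funM => //.
  exact: measurable_funB.
(* For x > 0 the integral of exp(-(l - 1) x) over l >= 1 is 1 / x, which lowers the exponent of the
   weight by one. *)
have -> : (\int[mu]_x (gamma_weight c x)%:E = \int[mu]_x \int[mu]_l f x l)%E.
  apply: eq_integral => x _; rewrite /f.
  have [x0|x0] := ltP 0 x; last first.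
    rewrite integral0_eq; last first.
      by move=> l _; rewrite /gamma_weight ltNge x0 mul0r mulr0.
    by rewrite /gamma_weight ltNge x0.
  transitivity ((gamma_weight (c + 1) x)%:E *
      \int[mu]_(l in `[1%R, +oo[) (expR (- ((l - 1) * x)))%:E)%E.
    rewrite integral_expR_itv1y// -EFinM /gamma_weight x0; congr EFin.
    rewrite addrK -(mulr_powRB1 (ltW x0) c0); field.
    by rewrite gt_eqF.
  rewrite uE -ge0_integralZl//.
  - by apply: eq_integral => l _; rewrite -EFinM; congr EFin; ring.
  - apply/measurable_EFinP; apply: measurable_funM => //.
    do 2 apply: measurableT_comp => //; apply: measurable_funM => //.
    exact: measurable_funB.
  - by move=> l _; rewrite lee_fin mulr_ge0// expR_ge0.
  - by rewrite lee_fin gamma_weight_ge0.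
rewrite (ge0_integral_swap mu mu mf f0).
have -> : (\int[mu]_l \int[mu]_x f x l = c^-1%:E * \int[mu]_x (gamma_weight (c + 1) x)%:E)%E.
  rewrite -integral_powR_itv1y// uE -ge0_integralZr//; last 3 first.
  - apply/measurable_EFinP; apply: measurable_funM; first exact: mu_.
    exact: measurable_powR.
  - by move=> l _; rewrite lee_fin mulr_ge0// powR_ge0.
  - exact: integral_gamma_weight_ge0.
  apply: eq_integral => l _; rewrite /f.
  under eq_integral do rewrite EFinM.
  rewrite ge0_integralZl//; last 3 first.
  - by apply/measurable_EFinP; exact: mwe.
  - by move=> x _; rewrite lee_fin mulr_ge0 ?gamma_weight_ge0 ?expR_ge0.
  - by rewrite lee_fin.
  rewrite {1}/u; case: ifPn => l1; last by rewrite mul0e /u (negbTE l1) mul0r mul0e.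
  rewrite mul1e integral_gamma_weight_laplace; last exact: lt_le_trans l1.
  by rewrite /u l1 mul1r.
by rewrite muleA -EFinM divff ?gt_eqF// mul1e.
Qed.

(** Positive integers follow from c = 1 by the functional equation. For real c >= 1, x^(c - 1) is at
    most 1 on ]0, 1] and at most an integer power beyond, so the weight is below the sum of two
    integer weights. *)
Lemma integral_gamma_weight_lty1 (c : R) : 1 <= c ->
  (\int[mu]_x (gamma_weight c x)%:E < +oo)%E.
Proof.
have le1 : (\int[mu]_x (gamma_weight 1 x)%:E <= 1)%E.
  apply: (@le_trans _ _ (\int[mu]_(l in `[1%R, +oo[) (expR (- ((l - 1) * 1)))%:E)%E);
    last by rewrite integral_expR_itv1y// invr1.
  (* The known exponential integral starts at 1; the shift moves ]0, +oo[ onto ]1, +oo[. *)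
  rewrite -(@ge0_integral_shift R (-1)); last 2 first.
  - by apply/measurable_EFinP; exact: measurable_gamma_weight.
  - by move=> x; rewrite lee_fin gamma_weight_ge0.
  rewrite [leRHS]integral_mkcond; apply: ge0_le_integral => //.
  - by move=> x _; rewrite lee_fin gamma_weight_ge0.
  - apply/measurable_EFinP; apply: (measurableT_comp (measurable_gamma_weight 1)).
    exact: measurable_funD.
  - apply/(measurable_restrictT _ _).1 => //; apply: measurable_funTS.
    apply/measurable_EFinP; do 2 apply: measurableT_comp => //.
    by apply: measurable_funM => //; exact: measurable_funB.
  move=> x _; rewrite patchE mem_setE in_itv/= andbT /gamma_weight subr_gt0.
  case: ltP => x1; first by rewrite (ltW x1) lee_fin subrr powRr0 mul1r mulr1.
  by case: ifP => // _; rewrite lee_fin expR_ge0.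
have ltyn n : (\int[mu]_x (gamma_weight n.+1%:R x)%:E < +oo)%E.
  elim: n => [|n IH]; first exact: le_lt_trans (ltry 1).
  by rewrite -natr1 integral_gamma_weightS// lte_mul_pinfty.
move=> c1; pose n := Num.truncn c.
apply: (@le_lt_trans _ _ (\int[mu]_x ((gamma_weight 1 x)%:E + (gamma_weight n.+2%:R x)%:E))%E).
  apply: ge0_le_integral => //.
  - by move=> x _; rewrite lee_fin gamma_weight_ge0.
  - by apply/measurable_EFinP; exact: measurable_gamma_weight.
  - by apply: emeasurable_funD; apply/measurable_EFinP; exact: measurable_gamma_weight.
  move=> x _; rewrite -EFinD lee_fin /gamma_weight; case: ifP => x0; last by rewrite addr0.
  rewrite -mulrDl ler_wpM2r ?expR_ge0// subrr powRr0.
  have [x1|x1] := leP x 1.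
    rewrite (@le_trans _ _ 1) ?lerDl ?powR_ge0//.
    have := @ge0_ler_powR R (c - 1) _ x 1; rewrite subr_ge0 powR1.
    by apply; rewrite // nnegrE ltW.
  rewrite (@le_trans _ _ (x `^ (n.+2%:R - 1))) ?lerDr//.
  apply: ler_powR; first exact: ltW.
  rewrite lerD2r -natr1.
  have /andP[_ /ltW] := truncn_itv (le_trans ler01 c1); rewrite -/n; lra.
rewrite ge0_integralD//.
- by rewrite lte_add_pinfty// (ltyn 0%N, ltyn n.+1).
- by move=> x _; rewrite lee_fin gamma_weight_ge0.
- by apply/measurable_EFinP; exact: measurable_gamma_weight.
- by move=> x _; rewrite lee_fin gamma_weight_ge0.
- by apply/measurable_EFinP; exact: measurable_gamma_weight.
Qed.

(** On [1, +oo[ the factor x^(c - 1) is at least 1, so the weight dominates exp(-1) exp(-(x -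
    1)). *)
Lemma integral_gamma_weight_gt01 (c : R) : 1 <= c ->
  (0 < \int[mu]_x (gamma_weight c x)%:E)%E.
Proof.
move=> c1; apply: (@lt_le_trans _ _ ((expR (-1))%:E *
    \int[mu]_(l in `[1%R, +oo[) (expR (- ((l - 1) * 1)))%:E)%E).
  by rewrite integral_expR_itv1y// invr1 mule1 lte_fin expR_gt0.
rewrite -ge0_integralZl//; last first.
  apply: measurable_funTS; apply/measurable_EFinP; do 2 apply: measurableT_comp => //.
  by apply: measurable_funM => //; exact: measurable_funB.
rewrite [leLHS]integral_mkcond; apply: ge0_le_integral => //.
- by move=> x _; rewrite patchE; case: ifP => // _; rewrite mule_ge0// lee_fin expR_ge0.
- apply/(measurable_restrictT _ _).1 => //; apply: measurable_funTS.
  apply/measurable_EFinP; apply: measurable_funM => //; do 2 apply: measurableT_comp => //.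
  by apply: measurable_funM => //; exact: measurable_funB.
- by apply/measurable_EFinP; exact: measurable_gamma_weight.
move=> x _; rewrite patchE mem_setE in_itv/= andbT.
case: ifPn => x1; last by rewrite lee_fin gamma_weight_ge0.
rewrite /gamma_weight (lt_le_trans ltr01 x1) lee_fin -expRD.
rewrite (_ : -1 - (x - 1) * 1 = - x); last by ring.
have : x `^ 0 <= x `^ (c - 1) by apply: ler_powR => //; rewrite subr_ge0.
by rewrite powRr0; apply: ler_peMl; exact: expR_ge0.
Qed.

(** [Gamma] is the [fine] of an extended integral, so finiteness is the point here. It descends from
    c + 1 >= 1: by the functional equation, an infinite integral at [c] would make the one at c + 1
    infinite. *)
Lemma integral_gamma_weight (c : R) : 0 < c ->
  (\int[mu]_x (gamma_weight c x)%:E)%E = (Gamma c)%:E.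
Proof.
move=> c0; rewrite GammaE fineK// ge0_fin_numE ?integral_gamma_weight_ge0//.
have := integral_gamma_weight_lty1 (c := c + 1); rewrite integral_gamma_weightS//.
have : (0 <= \int[mu]_x (gamma_weight c x)%:E)%E by exact: integral_gamma_weight_ge0.
case: (\int[mu]_x _)%E => [r||]; [by move=> *; rewrite ltry| |by []].
by move=> _; rewrite gt0_muley ?lte_fin// ltxx lerDr => /(_ (ltW c0)).
Qed.

Lemma GammaS (c : R) : 0 < c -> Gamma (c + 1) = c * Gamma c.
Proof.
move=> c0; have := integral_gamma_weightS c0.
by rewrite !integral_gamma_weight// ?addr_gt0// -EFinM => -[].
Qed.

Lemma Gamma_gt0 (c : R) : 0 < c -> 0 < Gamma c.
Proof.
move=> c0; rewrite -(pmulr_rgt0 _ c0) -GammaS// -lte_fin -integral_gamma_weight ?addr_gt0//.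
by apply: integral_gamma_weight_gt01; rewrite lerDr ltW.
Qed.

Lemma rising_Gamma (c : R) n : 0 < c -> rising c n * Gamma c = Gamma (c + n%:R).
Proof.
move=> c0; elim: n => [|n IH]; first by rewrite /rising big_ord0 mul1r addr0.
rewrite /rising big_ord_recr/= -/(rising c n) mulrAC IH mulrC -natr1 addrA GammaS//.
by rewrite ltr_pwDl.
Qed.

End gamma_function.
(** * Vectors of independent gamma variables *)

Section product_probability.
Local Open Scope ereal_scope.
Context d1 d2 (T1 : measurableType d1) (T2 : measurableType d2) (R : realType).
Context (P : probability T1 R) (Q : probability T2 R).

(** A separate name on which the probability structure is declared, so that products can be iterated
    as probabilities. *)
Definition product_prob : set (T1 * T2) -> \bar R := P \x Q.

HB.instance Definition _ := Measure.on product_prob.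

Let product_prob_setT : product_prob setT = 1.
Proof.
rewrite -setXTT [LHS]product_measure1E// -[RHS]mule1.
by congr (_ * _); exact: probability_setT.
Qed.

HB.instance Definition _ :=
  Measure_isProbability.Build _ _ _ product_prob product_prob_setT.

End product_probability.

Lemma ge0_integral_prob_cst d (T : measurableType d) (R : realType)
    (P : probability T R) (c : \bar R) : (\int[P]_x c = c)%E.
Proof. by rewrite integral_cst// [X in (_ * X)%E](@probability_setT _ _ _ P) mule1. Qed.

Section gamma_distribution.
Context {R : realType}.
Local Notation mu := (@lebesgue_measure R).

(* The Dirac mass at 0 for c <= 0: with this convention, vectors of independent
   gamma variables also cover the Dirichlet distributions on the faces. *)
Definition gamma_prob (c : R) : probability (measurableTypeR R) R :=
  let P0 : probability (measurableTypeR R) R := @dirac _ (measurableTypeR R) 0 R in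
  let D := density_measure mu (measurable_gamma_weight c) (gamma_weight_ge0 c) in
  if 0 < c then mnormalize D P0 : probability (measurableTypeR R) R else P0.

Lemma gamma_prob0 : gamma_prob 0 = @dirac _ (measurableTypeR R) 0 R :> (_ -> _).
Proof. by rewrite /gamma_prob ltxx. Qed.

Lemma ge0_integral_gamma_prob0 (f : R -> \bar R) : measurable_fun setT f ->
  (\int[gamma_prob 0%R]_x f x = f 0%R)%E.
Proof. by move=> mf; rewrite gamma_prob0 integral_dirac// diracT mul1e. Qed.

Lemma ge0_integral_gamma_prob (c : R) (f : R -> \bar R) : 0 < c ->
  measurable_fun setT f -> (forall x, (0 <= f x)%E) ->
  (\int[gamma_prob c]_x f x =
   (Gamma c)^-1%:E * \int[mu]_x (f x * (gamma_weight c x)%:E))%E.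
Proof.
move=> c0 mf f0.
have G0 := Gamma_gt0 c0.
have k0 : 0 <= (Gamma c)^-1 by rewrite invr_ge0 ltW.
pose D := density_measure mu (measurable_gamma_weight c) (gamma_weight_ge0 c).
rewrite -(ge0_integral_density mu (measurable_gamma_weight c) (gamma_weight_ge0 c))//.
transitivity (\int[mscale (NngNum k0) D]_x f x)%E; last first.
  by rewrite ge0_integral_mscale.
apply: eq_measure_integral => A mA _.
rewrite /gamma_prob c0 /= /mnormalize /mscale/=.
(* The total mass is [Gamma c], neither 0 nor +oo, so [mnormalize] does not take its fallback
   value. *)
rewrite [density_measure _ _ _ setT]integral_gamma_weight//.
by rewrite eqe gt_eqF//= muleC.
Qed.

(** A form of almost sure equality: the law is carried by ]0, +oo[ for c > 0 and by the point 0 for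
    c = 0, which the hypothesis [0 < c -> 0 < x] treats at once. *)
Lemma ge0_eq_integral_gamma_prob (c : R) (f g : R -> \bar R) : 0 <= c ->
  measurable_fun setT f -> (forall x, (0 <= f x)%E) ->
  measurable_fun setT g -> (forall x, (0 <= g x)%E) ->
  (forall x, 0 <= x -> (0 < c -> 0 < x) -> f x = g x) ->
  (\int[gamma_prob c]_x f x = \int[gamma_prob c]_x g x)%E.
Proof.
rewrite le_eqVlt => /predU1P[<-|c0] mf f0 mg g0 fg.
  by rewrite !ge0_integral_gamma_prob0// fg// ltxx.
rewrite !ge0_integral_gamma_prob//; congr (_ * _)%E; apply: eq_integral => x _.
rewrite /gamma_weight; case: ifP => x0; last by rewrite !mule0.
by rewrite fg// ltW.
Qed.

Lemma gamma_prob_laplace (c l : R) : 0 <= c -> 0 < l ->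
  (\int[gamma_prob c]_x (expR (- ((l - 1) * x)))%:E = (l `^ (- c))%:E)%E.
Proof.
move=> + l0.
have me : measurable_fun setT (fun x : R => (expR (- ((l - 1) * x)))%:E).
  by apply/measurable_EFinP; do 2 apply: measurableT_comp => //; exact: measurable_funM.
rewrite le_eqVlt => /predU1P[<-|c0].
  by rewrite ge0_integral_gamma_prob0// mulr0 oppr0 expR0 powRr0.
rewrite ge0_integral_gamma_prob//.
under eq_integral do rewrite -EFinM mulrC.
rewrite integral_gamma_weight_laplace// integral_gamma_weight//.
by rewrite -!EFinM; congr EFin; field; rewrite gt_eqF// Gamma_gt0.
Qed.

End gamma_distribution.

(** * Coordinatewise operations on tuples *)

Section tuple_operations.
Context {R : realType}.

Lemma tnth_cons_pair0 n (x : R) (t : n.-tuple R) : tnth (cons_pair (x, t)) ord0 = x.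
Proof. exact: tnth0. Qed.

Lemma tnth_cons_pair_lift n (x : R) (t : n.-tuple R) i :
  tnth (cons_pair (x, t)) (lift ord0 i) = tnth t i.
Proof. exact: tnthS. Qed.

Definition scale_tuple n (s : R) (y : n.-tuple R) : n.-tuple R :=
  [tuple s * tnth y i | i < n].

Definition add_tuple n (y z : n.-tuple R) : n.-tuple R :=
  [tuple tnth y i + tnth z i | i < n].

Definition sum_tuple n (y : n.-tuple R) : R := \sum_(i < n) tnth y i.

Lemma scale_cons_pair n (s x : R) (t : n.-tuple R) :
  scale_tuple s (cons_pair (x, t)) = cons_pair (s * x, scale_tuple s t).
Proof.
apply: eq_from_tnth => i; rewrite tnth_mktuple.
by case: (unliftP ord0 i) => [j|] ->;
  rewrite ?tnth_cons_pair0 ?tnth_cons_pair_lift// tnth_mktuple.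
Qed.

Lemma add_cons_pair n (x x' : R) (t t' : n.-tuple R) :
  add_tuple (cons_pair (x, t)) (cons_pair (x', t')) = cons_pair (x + x', add_tuple t t').
Proof.
apply: eq_from_tnth => i; rewrite tnth_mktuple.
by case: (unliftP ord0 i) => [j|] ->;
  rewrite ?tnth_cons_pair0 ?tnth_cons_pair_lift// tnth_mktuple.
Qed.

Lemma sum_cons_pair n (x : R) (t : n.-tuple R) :
  sum_tuple (cons_pair (x, t)) = x + sum_tuple t.
Proof.
rewrite /sum_tuple big_ord_recl tnth_cons_pair0; congr (_ + _).
by apply: eq_bigr => i _; rewrite tnth_cons_pair_lift.
Qed.

Lemma sum_scale_tuple n s (y : n.-tuple R) : sum_tuple (scale_tuple s y) = s * sum_tuple y.
Proof. by rewrite /sum_tuple mulr_sumr; apply: eq_bigr => i _; rewrite tnth_mktuple. Qed.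

Lemma complete_coordE d (x : d.-tuple R) :
  complete_coord x = cons_pair (1 - sum_tuple x, x).
Proof. by []. Qed.

Section measurability.
Context dd (T : measurableType dd).

Lemma measurable_fun_tnth n (f : T -> n.-tuple R) i :
  measurable_fun setT f -> measurable_fun setT (fun x => tnth (f x) i).
Proof. by move=> mf; apply: (measurableT_comp (measurable_tnth i)). Qed.

Lemma measurable_mktuple n (f : 'I_n -> T -> R) :
  (forall i, measurable_fun setT (f i)) ->
  measurable_fun setT (fun x => [tuple f i x | i < n]).
Proof.
move=> mf; apply/measurable_fun_tnthP => i.
by rewrite (_ : _ \o _ = f i)//; apply/funext => x; rewrite /= tnth_mktuple.
Qed.

Lemma measurable_cons_pair_comp n (f : T -> R) (g : T -> n.-tuple R) :
  measurable_fun setT f -> measurable_fun setT g ->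
  measurable_fun setT (fun x => cons_pair (f x, g x)).
Proof. by move=> mf mg; exact: measurable_cons. Qed.

Lemma measurable_scale_tuple n (f : T -> R) (g : T -> n.-tuple R) :
  measurable_fun setT f -> measurable_fun setT g ->
  measurable_fun setT (fun x => scale_tuple (f x) (g x)).
Proof.
move=> mf mg; apply: measurable_mktuple => i.
by apply: measurable_funM => //; exact: measurable_fun_tnth.
Qed.

Lemma measurable_add_tuple n (f g : T -> n.-tuple R) :
  measurable_fun setT f -> measurable_fun setT g ->
  measurable_fun setT (fun x => add_tuple (f x) (g x)).
Proof.
move=> mf mg; apply: measurable_mktuple => i.
by apply: measurable_funD => //; exact: measurable_fun_tnth.
Qed.

Lemma measurable_sum_tuple n (f : T -> n.-tuple R) :
  measurable_fun setT f -> measurable_fun setT (fun x => sum_tuple (f x)).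
Proof. by move=> mf; apply: measurable_sum => i; exact: measurable_fun_tnth. Qed.

End measurability.
End tuple_operations.

(** * Gamma vectors and Lebesgue measure, one coordinate at a time *)

Section product_integrals.
Context {R : realType}.
Local Notation mu := (@lebesgue_measure R).

Definition cons_mfun n : {mfun (measurableTypeR R * n.-tuple R)%type >-> n.+1.-tuple R} :=
  HB.pack (@cons_pair R n) (isMeasurableFun.Build _ _ (measurableTypeR R * n.-tuple R)%type
    (n.+1.-tuple R) _ (@measurable_cons_pair R n)).

(** The recursion through [cons_pair] mirrors that of [lebesgue_tuple], so the two measures can be
    compared by induction. *)
Fixpoint gamma_tuple n : ('I_n -> R) -> probability (n.-tuple R) R :=
  match n with
  | 0 => fun=> @dirac _ (0.-tuple R) [tuple] R : probability _ R
  | n'.+1 => fun b => distribution (product_prob (gamma_prob (b ord0))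
      (gamma_tuple (fun i => b (lift ord0 i)))) (cons_mfun n') : probability _ R
  end.

Lemma ge0_integral_gamma_tuple0 (b : 'I_0 -> R) (h : 0.-tuple R -> \bar R) :
  measurable_fun setT h -> (\int[gamma_tuple b]_y h y = h [tuple])%E.
Proof. by move=> mh; rewrite integral_dirac// diracT mul1e. Qed.

Lemma ge0_integral_gamma_tupleS n (b : 'I_n.+1 -> R) (h : n.+1.-tuple R -> \bar R) :
  measurable_fun setT h -> (forall y, (0 <= h y)%E) ->
  (\int[gamma_tuple b]_y h y = \int[gamma_prob (b ord0)]_x
     \int[gamma_tuple (fun i => b (lift ord0 i))]_t h (cons_pair (x, t)))%E.
Proof.
move=> mh h0; rewrite /= ge0_integral_distribution//.
apply: (@ge0_integral_prod _ _ _ _ _ (gamma_prob (b ord0))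
  (gamma_tuple (fun i => b (lift ord0 i))) (fun x t => h (cons_pair (x, t)))) => //.
apply: (measurableT_comp mh) => //; exact: measurable_cons_pair_comp.
Qed.

Lemma ge0_integral_lebesgue_tuple0 (h : 0.-tuple R -> \bar R) :
  measurable_fun setT h -> (\int[lebesgue_tuple 0]_y h y = h [tuple])%E.
Proof. by move=> mh; rewrite integral_dirac// diracT mul1e. Qed.

Lemma ge0_integral_lebesgue_tupleS n (h : n.+1.-tuple R -> \bar R) :
  measurable_fun setT h -> (forall y, (0 <= h y)%E) ->
  (\int[lebesgue_tuple n.+1]_y h y =
   \int[mu]_x \int[lebesgue_tuple n]_t h (cons_pair (x, t)))%E.
Proof.
move=> mh h0; rewrite /= /lebesgue_cons ge0_integral_pushforward//; last first.
  exact: measurable_cons_pair.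
apply: (@ge0_integral_prod _ _ _ _ _ mu (lebesgue_tuple n)
  (fun x t => h (cons_pair (x, t)))) => //.
apply: (measurableT_comp mh) => //; exact: measurable_cons_pair_comp.
Qed.

End product_integrals.
Section tuple_integrals.
Context {R : realType}.

Lemma measurable_slice n (h : n.+1.-tuple R -> \bar R) (x : R) :
  measurable_fun setT h -> measurable_fun setT (fun t : n.-tuple R => h (cons_pair (x, t))).
Proof. by move=> mh; apply: (measurableT_comp mh); exact: measurable_cons_pair_comp. Qed.

Lemma measurable_integral_slice n (m : {sigma_finite_measure set (n.-tuple R) -> \bar R})
    (h : n.+1.-tuple R -> \bar R) :
  measurable_fun setT h -> (forall y, (0 <= h y)%E) ->
  measurable_fun (setT : set (measurableTypeR R))
    (fun x => \int[m]_t h (cons_pair (x, t)))%E.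
Proof.
move=> mh h0; apply: (measurable_fun_ge0_integral (T1 := measurableTypeR R)) => //.
by apply: (measurableT_comp mh); exact: measurable_cons_pair_comp.
Qed.

Lemma ge0_eq_integral_gamma_tuple n (b : 'I_n -> R) (f g : n.-tuple R -> \bar R) :
  (forall i, 0 <= b i) ->
  measurable_fun setT f -> (forall y, (0 <= f y)%E) ->
  measurable_fun setT g -> (forall y, (0 <= g y)%E) ->
  (forall y, (forall i, 0 <= tnth y i) -> (forall i, 0 < b i -> 0 < tnth y i) ->
     f y = g y) ->
  (\int[gamma_tuple b]_y f y = \int[gamma_tuple b]_y g y)%E.
Proof.
elim: n b f g => [|n IH] b f g b0 mf f0 mg g0 fg.
  by rewrite !ge0_integral_gamma_tuple0//; apply: fg => -[].
rewrite !ge0_integral_gamma_tupleS//; apply: ge0_eq_integral_gamma_prob => //.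
- exact: measurable_integral_slice.
- by move=> x; exact: integral_ge0.
- exact: measurable_integral_slice.
- by move=> x; exact: integral_ge0.
move=> x x0 bx0; apply: IH => //; try exact: measurable_slice.
move=> y y0 by0; apply: fg => i; case: (unliftP ord0 i) => [j|] ->;
  rewrite ?tnth_cons_pair0 ?tnth_cons_pair_lift//; exact: by0.
Qed.

(** By independence the transform factors over the coordinates. The tilt is [f i - 1] because the
    gamma density already contains exp(-y_i). *)
Lemma gamma_tuple_laplace n (b f : 'I_n -> R) :
  (forall i, 0 <= b i) -> (forall i, 0 < f i) ->
  (\int[gamma_tuple b]_y (expR (- \sum_(i < n) (f i - 1) * tnth y i))%:E =
   (\prod_(i < n) f i `^ (- b i))%:E)%E.
Proof.
have mE m (g : 'I_m -> R) : measurable_fun setT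
    (fun y : m.-tuple R => (expR (- \sum_(i < m) (g i - 1) * tnth y i))%:E).
  apply/measurable_EFinP; do 2 apply: measurableT_comp => //.
  apply: measurable_sum => i; apply: measurable_funM => //.
  exact: measurable_fun_tnth.
elim: n b f => [|n IH] b f b0 f0.
  by rewrite ge0_integral_gamma_tuple0// !big_ord0 oppr0 expR0.
rewrite ge0_integral_gamma_tupleS//.
rewrite big_ord_recl EFinM -(IH (fun i => b (lift ord0 i)) (fun i => f (lift ord0 i)))//.
rewrite -gamma_prob_laplace// -ge0_integralZr//; last 2 first.
- apply/measurable_EFinP; do 2 apply: measurableT_comp => //; exact: measurable_funM.
- by apply: integral_ge0 => y _; rewrite lee_fin expR_ge0.
apply: eq_integral => x _; rewrite -ge0_integralZl//; last exact: mE.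
apply: eq_integral => t _; rewrite -EFinM -expRD big_ord_recl tnth_cons_pair0 opprD.
by congr (expR (_ - _))%:E; apply: eq_bigr => i _; rewrite tnth_cons_pair_lift.
Qed.

Definition gamma_tuple_pdf n (b : 'I_n -> R) (y : n.-tuple R) : R :=
  \prod_(i < n) ((Gamma (b i))^-1 * gamma_weight (b i) (tnth y i)).

Lemma gamma_tuple_pdfS n (b : 'I_n.+1 -> R) x (t : n.-tuple R) :
  gamma_tuple_pdf b (cons_pair (x, t)) = (Gamma (b ord0))^-1 * gamma_weight (b ord0) x *
    gamma_tuple_pdf (fun i => b (lift ord0 i)) t.
Proof.
rewrite /gamma_tuple_pdf big_ord_recl tnth_cons_pair0; congr (_ * _).
by apply: eq_bigr => i _; rewrite tnth_cons_pair_lift.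
Qed.

Lemma gamma_tuple_pdf_ge0 n (b : 'I_n -> R) y :
  (forall i, 0 < b i) -> 0 <= gamma_tuple_pdf b y.
Proof.
move=> b0; apply: prodr_ge0 => i _.
by rewrite mulr_ge0 ?gamma_weight_ge0// invr_ge0 ltW// Gamma_gt0.
Qed.

Lemma measurable_gamma_tuple_pdf n (b : 'I_n -> R) :
  measurable_fun setT (gamma_tuple_pdf b).
Proof.
apply: measurable_prod => i _; apply: measurable_funM => //.
by apply: (measurableT_comp (measurable_gamma_weight _)); exact: measurable_fun_tnth.
Qed.

Lemma ge0_integral_gamma_tuple n (b : 'I_n -> R) (h : n.-tuple R -> \bar R) :
  (forall i, 0 < b i) -> measurable_fun setT h -> (forall y, (0 <= h y)%E) ->
  (\int[gamma_tuple b]_y h y =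
   \int[lebesgue_tuple n]_y (h y * (gamma_tuple_pdf b y)%:E))%E.
Proof.
elim: n b h => [|n IH] b h b0 mh h0.
  rewrite ge0_integral_gamma_tuple0// ge0_integral_lebesgue_tuple0//.
    by rewrite /gamma_tuple_pdf big_ord0 mule1.
  by apply: emeasurable_funM => //; apply/measurable_EFinP; exact: measurable_gamma_tuple_pdf.
have mhp : measurable_fun setT (fun y => h y * (gamma_tuple_pdf b y)%:E)%E.
  by apply: emeasurable_funM => //; apply/measurable_EFinP; exact: measurable_gamma_tuple_pdf.
rewrite ge0_integral_gamma_tupleS// ge0_integral_lebesgue_tupleS//; last first.
  by move=> y; rewrite mule_ge0// lee_fin gamma_tuple_pdf_ge0.
rewrite ge0_integral_gamma_prob//; last 2 first.
- exact: measurable_integral_slice.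
- by move=> x; exact: integral_ge0.
rewrite -ge0_integralZl//; last 3 first.
- apply: emeasurable_funM; first exact: measurable_integral_slice.
  by apply/measurable_EFinP; exact: measurable_gamma_weight.
- by move=> x _; rewrite mule_ge0 ?integral_ge0// lee_fin gamma_weight_ge0.
- by rewrite lee_fin invr_ge0 ltW// Gamma_gt0.
apply: eq_integral => x _.
rewrite IH//; last exact: measurable_slice.
rewrite muleCA -EFinM -ge0_integralZr//; last 3 first.
- apply: emeasurable_funM; first exact: measurable_slice.
  by apply/measurable_EFinP; exact: measurable_gamma_tuple_pdf.
- by move=> t _; rewrite mule_ge0// lee_fin gamma_tuple_pdf_ge0.
- by rewrite lee_fin mulr_ge0 ?gamma_weight_ge0// invr_ge0 ltW// Gamma_gt0.
by apply: eq_integral => t _; rewrite -muleA -EFinM gamma_tuple_pdfS [in RHS]mulrC.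
Qed.

Lemma ge0_integral_lebesgue_tuple_scale n (s : R) (h : n.-tuple R -> \bar R) :
  0 < s -> measurable_fun setT h -> (forall y, (0 <= h y)%E) ->
  (\int[lebesgue_tuple n]_y h y =
   (s ^+ n)%:E * \int[lebesgue_tuple n]_y h (scale_tuple s y))%E.
Proof.
move=> s0; elim: n h => [|n IH] h mh h0.
  rewrite !ge0_integral_lebesgue_tuple0// ?expr0 ?mul1e.
    by congr h; apply: eq_from_tnth => -[].
  by apply: (measurableT_comp mh); exact: measurable_scale_tuple.
have msh : measurable_fun setT (fun y : n.+1.-tuple R => h (scale_tuple s y)).
  by apply: (measurableT_comp mh); exact: measurable_scale_tuple.
rewrite !ge0_integral_lebesgue_tupleS//.
rewrite (ge0_integral_scale s0)//; last 2 first.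
- exact: measurable_integral_slice.
- by move=> x; exact: integral_ge0.
rewrite exprS EFinM -muleA; congr (_ * _)%E.
rewrite -ge0_integralZl//; last 3 first.
- exact: (@measurable_integral_slice n (lebesgue_tuple n) (fun y => h (scale_tuple s y))).
- by move=> x _; exact: integral_ge0.
- by rewrite lee_fin exprn_ge0// ltW.
apply: eq_integral => x _; rewrite IH//; last exact: measurable_slice.
by congr (_ * _)%E; apply: eq_integral => t _; rewrite scale_cons_pair.
Qed.

End tuple_integrals.
(** * Polar decomposition of gamma vectors and Dirichlet distributions *)

Section polar_coordinates.
Context {R : realType}.
Local Notation mu := (@lebesgue_measure R).

(** The cut-off encodes the constraints of the open simplex coordinate by coordinate. *)
Definition pos_powR (c x : R) : R := if 0 < x then x `^ c else 0.

Lemma pos_powR_ge0 c x : 0 <= pos_powR c x.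
Proof. by rewrite /pos_powR; case: ifP => // _; exact: powR_ge0. Qed.

Lemma measurable_pos_powR c : measurable_fun setT (pos_powR c).
Proof.
apply: measurable_fun_if => //=; first exact: measurable_fun_ltr.
by apply: measurable_funTS; exact: measurable_powR.
Qed.

(* Extension of the Dirichlet density to a function of all d + 1 barycentric
   coordinates, vanishing off the open simplex. *)
Definition simplex_pdf n (b : 'I_n -> R) (y : n.-tuple R) : R :=
  Gamma (\sum_(i < n) b i) *
  \prod_(i < n) ((Gamma (b i))^-1 * pos_powR (b i - 1) (tnth y i)).

Lemma measurable_simplex_pdf n (b : 'I_n -> R) : measurable_fun setT (simplex_pdf b).
Proof.
apply: measurable_funM => //; apply: measurable_prod => i _.
apply: measurable_funM => //; apply: (measurableT_comp (measurable_pos_powR _)).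
exact: measurable_fun_tnth.
Qed.

Lemma sum_gt0 n (b : 'I_n.+1 -> R) : (forall i, 0 < b i) -> 0 < \sum_(i < n.+1) b i.
Proof.
move=> b0; rewrite big_ord_recl ltr_pwDl// sumr_ge0// => i _; exact: ltW.
Qed.

Lemma simplex_pdf_ge0 n (b : 'I_n.+1 -> R) y : (forall i, 0 < b i) -> 0 <= simplex_pdf b y.
Proof.
move=> b0; rewrite mulr_ge0 ?(ltW (Gamma_gt0 _)) ?sum_gt0// prodr_ge0// => i _.
by rewrite mulr_ge0 ?pos_powR_ge0// invr_ge0 ltW// Gamma_gt0.
Qed.

Lemma prod_powR n (c : 'I_n -> R) (s : R) : 0 < s ->
  \prod_(i < n) s `^ c i = s `^ (\sum_(i < n) c i).
Proof.
move=> s0; rewrite (big_morph (fun u => s `^ u) (id1 := 1) (op1 := *%R))//.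
- by move=> u v; rewrite powRD// (gt_eqF s0) implybT.
- exact: powRr0.
Qed.

(** Separation of mass and direction: the Jacobian s^n of dilating n free coordinates, times the n +
    1 factors s^(b_i - 1), is s^(|b| - 1), and the exponentials multiply to exp(-s) because [y] has
    sum 1. *)
Lemma gamma_tuple_pdf_scale n (b : 'I_n.+1 -> R) (s : R) (y : n.+1.-tuple R) :
  (forall i, 0 < b i) -> 0 < s -> sum_tuple y = 1 ->
  s ^+ n * gamma_tuple_pdf b (scale_tuple s y) =
  (Gamma (\sum_(i < n.+1) b i))^-1 * gamma_weight (\sum_(i < n.+1) b i) s *
  simplex_pdf b y.
Proof.
move=> b0 s0 y1.
have G0 : Gamma (\sum_(i < n.+1) b i) != 0 by rewrite gt_eqF// Gamma_gt0// sum_gt0.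
have wE i : gamma_weight (b i) (tnth (scale_tuple s y) i) =
    s `^ (b i - 1) * (expR (- (s * tnth y i)) * pos_powR (b i - 1) (tnth y i)).
  rewrite tnth_mktuple /gamma_weight /pos_powR pmulr_rgt0//.
  case: ifP => y0; last by rewrite !mulr0.
  by rewrite powRM ?ltW//; ring.
rewrite /gamma_tuple_pdf /simplex_pdf.
under eq_bigr do rewrite wE mulrCA.
under eq_bigr do rewrite [_ * (expR _ * _)]mulrCA.
rewrite !big_split/= prod_powR// -expR_sum sumrN -mulr_sumr [X in s * X]y1 mulr1.
rewrite sumrB sumr_const card_ord /gamma_weight s0.
have -> : s `^ (\sum_(i < n.+1) b i - 1) =
    s ^+ n * s `^ (\sum_(i < n.+1) b i - 1 *+ n.+1).
  rewrite -powR_mulrn ?ltW// -powRD ?(gt_eqF s0) ?implybT//; congr (_ `^ _).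
  by rewrite -natr1; ring.
by field.
Qed.

(** The substitution y = s (1 - sum x, x) is made in two moves: a translation turns the first
    coordinate into the total mass s, then the other coordinates are dilated by s. *)
Lemma ge0_integral_gamma_tuple_polar d (b : 'I_d.+1 -> R) (h : d.+1.-tuple R -> \bar R) :
  (forall i, 0 < b i) -> measurable_fun setT h -> (forall y, (0 <= h y)%E) ->
  (\int[gamma_tuple b]_y h y =
   \int[gamma_prob (\sum_(i < d.+1) b i)]_s
     \int[lebesgue_tuple d]_x (h (scale_tuple s (complete_coord x)) *
       (simplex_pdf b (complete_coord x))%:E))%E.
Proof.
move=> b0 mh h0; rewrite ge0_integral_gamma_tuple//.
pose F y := (h y * (gamma_tuple_pdf b y)%:E)%E.
have mF : measurable_fun setT F.
  by apply: emeasurable_funM => //; apply/measurable_EFinP; exact: measurable_gamma_tuple_pdf.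
have F0 y : (0 <= F y)%E by rewrite mule_ge0// lee_fin gamma_tuple_pdf_ge0.
have mq : measurable_fun setT (fun x : d.-tuple R => simplex_pdf b (complete_coord x)).
  apply: (measurableT_comp (measurable_simplex_pdf b)).
  apply: measurable_cons_pair_comp => //.
  by apply: measurable_funB => //; exact: measurable_sum_tuple.
have mhs : measurable_fun (setT : set (measurableTypeR R * d.-tuple R))
    (fun p => h (scale_tuple p.1 (complete_coord p.2)) *
       (simplex_pdf b (complete_coord p.2))%:E)%E.
  apply: emeasurable_funM.
    apply: (measurableT_comp mh); apply: measurable_scale_tuple => //.
    apply: measurable_cons_pair_comp => //; apply: measurable_funB => //.
    exact: measurable_sum_tuple.
  by apply/measurable_EFinP; apply: (measurableT_comp mq).
have hs0 s x : (0 <= h (scale_tuple s (complete_coord x)) *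
    (simplex_pdf b (complete_coord x))%:E)%E.
  by rewrite mule_ge0// lee_fin simplex_pdf_ge0.
rewrite [LHS]ge0_integral_lebesgue_tupleS//.
rewrite (ge0_integral_swap mu (lebesgue_tuple d)
  (f := fun x t => F (cons_pair (x, t))))//; last first.
  by apply: (measurableT_comp mF); exact: measurable_cons_pair_comp.
(* With the other coordinates [t] fixed, the total mass [s] replaces the first coordinate. *)
transitivity (\int[lebesgue_tuple d]_t \int[mu]_s F (cons_pair ((s - sum_tuple t)%R, t)))%E.
  apply: eq_integral => t _.
  rewrite -(@ge0_integral_shift R (- sum_tuple t) (fun s => F (cons_pair (s, t))))//.
  by apply: (measurableT_comp mF); exact: measurable_cons_pair_comp.
have msh : measurable_fun (setT : set (measurableTypeR R * d.-tuple R))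
    (fun p => F (cons_pair (p.1 - sum_tuple p.2, p.2))).
  apply: (measurableT_comp mF); apply: measurable_cons_pair_comp => //.
  by apply: measurable_funB => //; exact: measurable_sum_tuple.
rewrite -(ge0_integral_swap mu (lebesgue_tuple d)
  (f := fun s t => F (cons_pair (s - sum_tuple t, t))))//.
rewrite ge0_integral_gamma_prob ?sum_gt0//; last 2 first.
- exact: (measurable_fun_ge0_integral (lebesgue_tuple d) mhs).
- by move=> s; exact: integral_ge0.
rewrite -ge0_integralZl//; last 3 first.
- apply: emeasurable_funM; last by apply/measurable_EFinP; exact: measurable_gamma_weight.
  exact: (measurable_fun_ge0_integral (lebesgue_tuple d) mhs).
- by move=> s _; rewrite mule_ge0 ?integral_ge0// lee_fin gamma_weight_ge0.
- by rewrite lee_fin invr_ge0 ltW// Gamma_gt0// sum_gt0.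
apply: eq_integral => s _.
(* For s <= 0 the coordinates sum to s, so one of them is nonpositive and the gamma density
   vanishes, as does the radial weight. *)
have [s0|s0] := ltP 0 s; last first.
  rewrite [in RHS]/gamma_weight ltNge s0 mule0 mule0 integral0_eq// => t _.
  rewrite /F; suff -> : gamma_tuple_pdf b (cons_pair (s - sum_tuple t, t)) = 0 by rewrite mule0.
  have [i /negP yi] : exists i, ~~ (0 < tnth (cons_pair (s - sum_tuple t, t)) i).
    apply/existsP; rewrite -negb_forall; apply/negP => /forallP y0.
    have : 0 < sum_tuple (cons_pair (s - sum_tuple t, t)).
      by apply: sum_gt0 => i; exact: y0.
    by rewrite sum_cons_pair subrK ltNge s0.
  rewrite /gamma_tuple_pdf (bigD1 i)//= /gamma_weight; case: ifP => [/yi//|_].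
  by rewrite mulr0 mul0r.
rewrite [LHS](ge0_integral_lebesgue_tuple_scale s0)//; last first.
  by apply: (measurableT_comp mF); apply: measurable_cons_pair_comp => //;
    apply: measurable_funB => //; exact: measurable_sum_tuple.
rewrite -[LHS]ge0_integralZl//; last 2 first.
- by apply: (measurableT_comp mF); apply: measurable_cons_pair_comp;
    [apply: measurable_funB => //; apply: measurable_sum_tuple|];
    exact: measurable_scale_tuple.
- by rewrite lee_fin exprn_ge0// ltW.
rewrite muleCA -EFinM -[RHS]ge0_integralZr//; last 2 first.
- exact: (measurableT_comp mhs (measurable_pair1 _)).
- by rewrite lee_fin mulr_ge0 ?gamma_weight_ge0// invr_ge0 ltW// Gamma_gt0// sum_gt0.
apply: eq_integral => x _.
have -> : cons_pair (s - sum_tuple (scale_tuple s x), scale_tuple s x) =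
    scale_tuple s (complete_coord x).
  by rewrite complete_coordE scale_cons_pair sum_scale_tuple mulrBr mulr1.
have y1 : sum_tuple (complete_coord x) = 1.
  by rewrite complete_coordE sum_cons_pair subrK.
by rewrite /F muleCA -muleA -!EFinM gamma_tuple_pdf_scale// [in LHS]mulrC.
Qed.

End polar_coordinates.

(** * Dirichlet laws as directions of gamma vectors *)

Section normalized_gamma.
Context {R : realType}.

(* The power is the inverse for positive sums; elsewhere the value is junk. *)
Definition normalize_tuple n (y : n.-tuple R) : n.-tuple R :=
  scale_tuple (sum_tuple y `^ (-1)) y.

Lemma measurable_normalize_tuple n : measurable_fun setT (@normalize_tuple n).
Proof.
apply: measurable_scale_tuple => //.
apply: (measurableT_comp (measurable_powR (-1))); exact: measurable_sum_tuple.
Qed.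

Lemma scale_tupleA n (s t : R) (y : n.-tuple R) :
  scale_tuple s (scale_tuple t y) = scale_tuple (s * t) y.
Proof. by apply: eq_from_tnth => i; rewrite !tnth_mktuple mulrA. Qed.

Lemma scale_tuple1 n (y : n.-tuple R) : scale_tuple 1 y = y.
Proof. by apply: eq_from_tnth => i; rewrite !tnth_mktuple mul1r. Qed.

Lemma normalize_scale_tuple n (s : R) (y : n.-tuple R) :
  0 < s -> sum_tuple y = 1 -> normalize_tuple (scale_tuple s y) = y.
Proof.
move=> s0 y1; rewrite /normalize_tuple sum_scale_tuple y1 mulr1 scale_tupleA.
by rewrite powR_inv1 ?ltW// mulVf ?gt_eqF// scale_tuple1.
Qed.

Definition normalize_mfun n : {mfun n.-tuple R >-> n.-tuple R} :=
  HB.pack (@normalize_tuple n)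
    (isMeasurableFun.Build _ _ _ _ _ (@measurable_normalize_tuple n)).

(** Defined without a density, so that the open simplex and all its faces are covered uniformly. *)
Definition dirichlet_prob n (b : 'I_n -> R) : probability (n.-tuple R) R :=
  distribution (gamma_tuple b) (normalize_mfun n).

Lemma ge0_integral_dirichlet_prob n (b : 'I_n -> R) (g : n.-tuple R -> \bar R) :
  measurable_fun setT g -> (forall y, (0 <= g y)%E) ->
  (\int[dirichlet_prob b]_x g x = \int[gamma_tuple b]_y g (normalize_tuple y))%E.
Proof. by move=> mg g0; rewrite ge0_integral_distribution. Qed.

Lemma sum_complete_coord d (x : d.-tuple R) : sum_tuple (complete_coord x) = 1.
Proof. by rewrite complete_coordE sum_cons_pair subrK. Qed.

Lemma measurable_complete_coord d : measurable_fun setT (@complete_coord R d).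
Proof.
apply: measurable_cons_pair_comp => //.
by apply: measurable_funB => //; exact: measurable_sum_tuple.
Qed.

(** In polar coordinates normalization erases the mass s, and the radial law then integrates a
    constant. *)
Lemma ge0_integral_dirichlet_prob_pdf d (b : 'I_d.+1 -> R) (g : d.+1.-tuple R -> \bar R) :
  (forall i, 0 < b i) -> measurable_fun setT g -> (forall y, (0 <= g y)%E) ->
  (\int[dirichlet_prob b]_x g x =
   \int[lebesgue_tuple d]_x (g (complete_coord x) *
     (simplex_pdf b (complete_coord x))%:E))%E.
Proof.
move=> b0 mg g0; rewrite ge0_integral_dirichlet_prob//.
have mgn : measurable_fun setT (fun y => g (normalize_tuple y)).
  by apply: (measurableT_comp mg); exact: measurable_normalize_tuple.
have mq : measurable_fun setT (fun x : d.-tuple R => (simplex_pdf b (complete_coord x))%:E).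
  apply/measurable_EFinP; apply: (measurableT_comp (measurable_simplex_pdf b)).
  exact: measurable_complete_coord.
rewrite ge0_integral_gamma_tuple_polar//.
rewrite -[RHS](ge0_integral_prob_cst (gamma_prob (\sum_(i < d.+1) b i))).
apply: ge0_eq_integral_gamma_prob => //.
- exact/ltW/sum_gt0.
- apply: (measurable_fun_ge0_integral (T1 := measurableTypeR R)) => /=.
    apply: emeasurable_funM; last exact: (measurableT_comp mq).
    apply: (measurableT_comp mgn); apply: measurable_scale_tuple => //.
    by apply: (measurableT_comp (@measurable_complete_coord d)).
  by move=> s x; rewrite mule_ge0// lee_fin simplex_pdf_ge0.
- by move=> s; apply: integral_ge0 => x _; rewrite mule_ge0// lee_fin simplex_pdf_ge0.
- by move=> s; apply: integral_ge0 => x _; rewrite mule_ge0// lee_fin simplex_pdf_ge0.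
move=> s s0 /(_ (sum_gt0 b0)) s_gt0; apply: eq_integral => x _.
by rewrite normalize_scale_tuple// sum_complete_coord.
Qed.

Lemma gamma_tuple_polar_gt0 d (b : 'I_d.+1 -> R) (h : d.+1.-tuple R -> \bar R) :
  (forall i, 0 < b i) -> measurable_fun setT h -> (forall y, (0 <= h y)%E) ->
  (\int[gamma_tuple b]_y h y =
   \int[gamma_prob (\sum_(i < d.+1) b i)]_s
     \int[dirichlet_prob b]_x h (scale_tuple s x))%E.
Proof.
move=> b0 mh h0; rewrite ge0_integral_gamma_tuple_polar//.
apply: eq_integral => s _; rewrite ge0_integral_dirichlet_prob_pdf//.
by apply: (measurableT_comp mh); exact: measurable_scale_tuple.
Qed.

Lemma dirichletE d (b : 'I_d.+1 -> R) (A : set (d.+1.-tuple R)) :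
  (forall i, 0 < b i) -> measurable A -> dirichlet b A = dirichlet_prob b A.
Proof.
move=> b0 mA.
have m1A : measurable_fun setT (fun y => (\1_A y)%:E : \bar R).
  by apply/measurable_EFinP.
transitivity (\int[dirichlet_prob b]_x (\1_A x)%:E)%E; last first.
  by rewrite integral_indic// setIT.
rewrite ge0_integral_dirichlet_prob_pdf//.
rewrite /dirichlet integral_mkcond; apply: eq_integral => x _.
rewrite patchE -EFinM indicE.
have [/set_mem xA|xA] := boolP (complete_coord x \in A); last first.
  rewrite mul0r ifF//; apply/negbTE; apply: contra xA => /set_mem[_ Ax].
  exact/mem_set.
rewrite mul1r /simplex_pdf.
case: ifPn => [/set_mem[[/= x0 x1] _]|xc].
  congr EFin; rewrite /dirichlet_pdf -mulrA -mulrA; congr (_ * _).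
  rewrite big_split/= -prodfV; congr (_ * _).
  rewrite big_ord_recl complete_coordE tnth_cons_pair0; congr (_ * _).
    by rewrite /pos_powR subr_gt0 x1.
  by apply: eq_bigr => i _; rewrite tnth_cons_pair_lift /pos_powR x0.
(* Off the open corner some barycentric coordinate is nonpositive, and its factor makes
   [simplex_pdf] vanish. *)
have [i /negP xi] : exists i, ~~ (0 < tnth (complete_coord x) i).
  apply/existsP; rewrite -negb_forall; apply: contra xc => /forallP x0.
  apply/mem_set; split=> //; split=> [i|].
    by have := x0 (lift ord0 i); rewrite complete_coordE tnth_cons_pair_lift.
  by have := x0 ord0; rewrite complete_coordE tnth_cons_pair0 subr_gt0.
have p0 : pos_powR (b i - 1) (tnth (complete_coord x) i) = 0.
  by rewrite /pos_powR; case: ifP.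
by rewrite [X in _ * X](bigD1 i)//= p0 mulr0 mul0r mulr0.
Qed.

End normalized_gamma.

(** * Faces of the simplex *)

Section faces.
Context {R : realType}.

(* face_embed for an arbitrary ambient dimension, which may be 0. *)
Definition embed n m (s : seq 'I_n) (y : m.-tuple R) : n.-tuple R :=
  [tuple nth 0 y (index i s) | i < n].

Lemma measurable_embed n m (s : seq 'I_n) : measurable_fun setT (@embed n m s).
Proof.
apply: measurable_mktuple => i; have [im|mi] := ltnP (index i s) m.
  apply: (eq_measurable_fun (fun y : m.-tuple R => tnth y (Ordinal im))).
    by move=> y _; rewrite (tnth_nth 0).
  exact: measurable_fun_tnth.
apply: (eq_measurable_fun (fun=> 0 : R)) => [y _|]; last exact: measurable_cst.
by rewrite nth_default// size_tuple.
Qed.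

Lemma embed_scale n m (s : seq 'I_n) (u : R) (y : m.-tuple R) :
  embed s (scale_tuple u y) = scale_tuple u (embed s y).
Proof.
apply: eq_from_tnth => i; rewrite !tnth_mktuple.
have [im|mi] := ltnP (index i s) m; last by rewrite !nth_default ?size_tuple// mulr0.
have := tnth_mktuple (fun i => u * tnth y i) (Ordinal im).
by rewrite (tnth_nth 0) (tnth_nth 0 y).
Qed.

Lemma sum_embed n m (s : seq 'I_n) (y : m.-tuple R) :
  uniq s -> size s = m -> sum_tuple (embed s y) = sum_tuple y.
Proof.
move=> us sm; rewrite /sum_tuple.
under eq_bigr do rewrite tnth_mktuple.
rewrite (bigID (mem s))/= [X in _ + X]big1 ?addr0; last first.
  by move=> i si; rewrite nth_default// memNindex// size_tuple sm.
rewrite -big_uniq//=; case: s us sm => [|i0 s] us sm.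
  by move: y; rewrite -sm => y; rewrite big_nil big_ord0.
rewrite (big_nth i0) sm big_mkord; apply: eq_bigr => j _.
by rewrite index_uniq ?sm// -tnth_nth.
Qed.

Lemma embed_cons0 n m (s : seq 'I_n) (x : R) (t : m.-tuple R) :
  embed (ord0 :: map (lift ord0) s) (cons_pair (x, t)) = cons_pair (x, embed s t).
Proof.
apply: eq_from_tnth => i; rewrite tnth_mktuple.
case: (unliftP ord0 i) => [j|] ->; rewrite ?tnth_cons_pair0 ?tnth_cons_pair_lift//.
by rewrite tnth_mktuple /= (index_map (@lift_inj _ ord0)).
Qed.

Lemma embed_map_lift n m (s : seq 'I_n) (t : m.-tuple R) : size s = m ->
  embed (map (lift ord0) s) t = cons_pair (0, embed s t).
Proof.
move=> sm; apply: eq_from_tnth => i; rewrite tnth_mktuple.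
case: (unliftP ord0 i) => [j|] ->; rewrite ?tnth_cons_pair0 ?tnth_cons_pair_lift.
  by rewrite tnth_mktuple (index_map (@lift_inj _ ord0)).
rewrite nth_default// memNindex ?size_map ?size_tuple ?sm//.
by apply/mapP => -[j _] /eqP; rewrite -val_eqE.
Qed.

(** Coordinates of parameter 0 are constantly 0 and can be deleted. Tying [c] to [b] by an equality
    of lists leaves [m] free, so the induction can keep or drop the head coordinate. *)
Lemma ge0_integral_gamma_tuple_embed n (b : 'I_n -> R) m (c : 'I_m -> R)
    (h : n.-tuple R -> \bar R) :
  (forall i, 0 <= b i) ->
  [seq c j | j <- enum 'I_m] = [seq b i | i <- enum 'I_n & 0 < b i] ->
  measurable_fun setT h -> (forall y, (0 <= h y)%E) ->
  (\int[gamma_tuple b]_y h y =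
   \int[gamma_tuple c]_y h (embed [seq i <- enum 'I_n | (0 < b i)%R] y))%E.
Proof.
elim: n b m c h => [|n IH] b m c h b0 cb mh h0.
  move: cb; rewrite (_ : enum 'I_0 = [::])/=; last first.
    by apply/eqP; rewrite -size_eq0 size_enum_ord.
  move=> cb; have m0 : m = 0%N by have := congr1 size cb; rewrite size_map size_enum_ord.
  subst m; rewrite !ge0_integral_gamma_tuple0//.
    by congr h; apply: eq_from_tnth => -[].
  by apply: (measurableT_comp mh); exact: measurable_embed.
have mhe k s : measurable_fun setT (fun y : k.-tuple R => h (embed s y)).
  by apply: (measurableT_comp mh); exact: measurable_embed.
pose s' := [seq i <- enum 'I_n | 0 < b (lift ord0 i)].
have mapE : [seq i <- map (lift ord0) (enum 'I_n) | 0 < b i] = map (lift ord0) s'.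
  by rewrite filter_map.
move: cb; rewrite ge0_integral_gamma_tupleS// enum_ordSl/= mapE.
case: ifPn => [bp|].
  case: m c => [|m] c; first by rewrite (size0nil (size_enum_ord 0)).
  rewrite enum_ordSl/= => -[cb0 cb].
  have mhE := mhe m.+1 (ord0 :: map (lift ord0) s').
  rewrite [RHS](@ge0_integral_gamma_tupleS _ m c _ mhE (fun=> h0 _)).
  rewrite cb0.
  apply: eq_integral => x _.
  rewrite (IH _ m (fun j => c (lift ord0 j)))//.
  - by apply: eq_integral => t _; rewrite embed_cons0.
  - by rewrite [LHS](map_comp c) cb -map_comp.
  - exact: measurable_slice.
rewrite -leNgt => bn cb.
have -> : b ord0 = 0 by apply/eqP; rewrite eq_le bn b0.
rewrite ge0_integral_gamma_prob0; last exact: measurable_integral_slice.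
rewrite (IH _ m c)//; last 2 first.
- by rewrite cb -map_comp.
- exact: measurable_slice.
apply: eq_integral => t _; rewrite embed_map_lift//.
by have := congr1 size cb; rewrite size_map size_enum_ord => ->; rewrite !size_map.
Qed.

Section reduction.
Context (d : nat) (b : 'I_d.+1 -> R).
Hypothesis (b0 : forall i, 0 <= b i).
Let s := [seq i <- enum 'I_d.+1 | 0 < b i].
Context (i0 : 'I_d.+1) (s' : seq 'I_d.+1) (sE : s = i0 :: s').
(** The same expression as in [dirichlet_face], whose match exposes the list of positive indices as
    [i0 :: s']. *)
Let c (j : 'I_(size s').+1) : R := b (nth i0 (i0 :: s') j).

Lemma face_param_gt0 j : 0 < c j.
Proof.
have : nth i0 (i0 :: s') j \in s by rewrite sE mem_nth.
by rewrite mem_filter => /andP[].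
Qed.

Let cE : [seq c j | j <- enum 'I_(size s').+1] = [seq b i | i <- s].
Proof.
have se : size [seq c j | j <- enum 'I_(size s').+1] = (size s').+1.
  by rewrite size_map size_enum_ord.
rewrite sE; apply: (@eq_from_nth _ 0); rewrite se ?size_map// => j jm.
rewrite (nth_map ord0) ?size_enum_ord// (nth_map i0)//.
by rewrite /c nth_enum_ord.
Qed.

Lemma sum_face_param : \sum_j c j = \sum_(i < d.+1) b i.
Proof.
have := congr1 (fun l => \sum_(x <- l) x) cE.
rewrite big_map big_enum/= => ->; rewrite big_map big_filter big_enum_cond big_mkcond/=.
apply: eq_bigr => i _; case: ltP => // bi.
by apply/eqP; rewrite eq_le b0 bi.
Qed.

Lemma ge0_integral_gamma_tuple_face (h : d.+1.-tuple R -> \bar R) :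
  measurable_fun setT h -> (forall y, (0 <= h y)%E) ->
  (\int[gamma_tuple b]_y h y = \int[gamma_tuple c]_y h (face_embed (i0 :: s') y))%E.
Proof.
by move=> mh h0; rewrite (ge0_integral_gamma_tuple_embed b0 cE mh h0) -/s sE.
Qed.

Lemma measurable_face_embed : measurable_fun setT (@face_embed R d (size s').+1 (i0 :: s')).
Proof. exact: measurable_embed. Qed.

(** Embedding a face preserves the total mass and commutes with scaling, hence with
    normalization. *)
Lemma ge0_integral_dirichlet_prob_face (g : d.+1.-tuple R -> \bar R) :
  measurable_fun setT g -> (forall y, (0 <= g y)%E) ->
  (\int[dirichlet_prob b]_y g y = \int[dirichlet_prob c]_y g (face_embed (i0 :: s') y))%E.
Proof.
move=> mg g0; have mgf := measurableT_comp mg measurable_face_embed.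
have mgn := measurableT_comp mg (@measurable_normalize_tuple R d.+1).
rewrite (ge0_integral_dirichlet_prob b mg g0).
rewrite [RHS](ge0_integral_dirichlet_prob c mgf (fun=> g0 _)).
rewrite (ge0_integral_gamma_tuple_face mgn (fun=> g0 _)).
apply: eq_integral => y _ /=; congr g.
rewrite /normalize_tuple [RHS]embed_scale; congr scale_tuple; congr (_ `^ _).
by apply: sum_embed; rewrite // -sE filter_uniq// enum_uniq.
Qed.

End reduction.

(** Independence of mass and direction on every face: restrict to the positive parameters, where
    densities exist, and embed back. *)
Lemma gamma_tuple_polar d (b : 'I_d.+1 -> R) (h : d.+1.-tuple R -> \bar R) :
  (forall i, 0 <= b i) -> 0 < \sum_(i < d.+1) b i ->
  measurable_fun setT h -> (forall y, (0 <= h y)%E) ->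
  (\int[gamma_tuple b]_y h y =
   \int[gamma_prob (\sum_(i < d.+1) b i)]_s
     \int[dirichlet_prob b]_x h (scale_tuple s x))%E.
Proof.
move=> b0 bs mh h0.
case sE : [seq i <- enum 'I_d.+1 | 0 < b i] => [|i0 s'].
  move: bs; rewrite big1 ?ltxx// => i _; apply/eqP; rewrite eq_le b0 andbT leNgt.
  by apply/negP => bi; have : i \in [::] by rewrite -sE mem_filter bi mem_enum.
have mhf := measurableT_comp mh (@measurable_face_embed d i0 s').
rewrite (ge0_integral_gamma_tuple_face b0 sE mh h0).
rewrite (gamma_tuple_polar_gt0 (face_param_gt0 sE) mhf (fun=> h0 _)).
rewrite (sum_face_param b0 sE); apply: eq_integral => s _.
have mhs : measurable_fun setT (fun x => h (scale_tuple s x)).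
  by apply: (measurableT_comp mh); exact: measurable_scale_tuple.
rewrite (ge0_integral_dirichlet_prob_face b0 sE mhs (fun=> h0 _)).
by apply: eq_integral => y _; rewrite /= [face_embed _ _]embed_scale.
Qed.

(** The singleton case of [dirichlet_face] is a Dirac mass by definition; this identifies it with a
    Dirichlet law on a simplex reduced to a point. *)
Lemma dirichlet_prob1 (c : 'I_1 -> R) (A : set (1.-tuple R)) :
  (forall i, 0 < c i) -> measurable A -> dirichlet_prob c A = \d_([tuple 1] : 1.-tuple R) A.
Proof.
move=> c0 mA.
have m1A : measurable_fun setT (fun y : 1.-tuple R => (\1_A y)%:E : \bar R).
  by apply/measurable_EFinP.
transitivity (\int[dirichlet_prob c]_x (\1_A x)%:E)%E.
  by rewrite integral_indic// setIT.
rewrite ge0_integral_dirichlet_prob_pdf// ge0_integral_lebesgue_tuple0; last first.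
  apply: emeasurable_funM.
    by apply: (measurableT_comp m1A); exact: measurable_complete_coord.
  apply/measurable_EFinP; apply: (measurableT_comp (measurable_simplex_pdf c)).
  exact: measurable_complete_coord.
have -> : complete_coord [tuple] = [tuple 1 : R].
  by apply: val_inj => /=; rewrite big_ord0 subr0.
rewrite /simplex_pdf !big_ord1 /pos_powR (tnth_nth 0)/= ltr01 powR1 mulr1.
by rewrite divff ?mule1 ?indicE ?diracE// gt_eqF// Gamma_gt0.
Qed.

Lemma dirichlet_faceE d (b : 'I_d.+1 -> R) (A : set (d.+1.-tuple R)) :
  (forall i, 0 <= b i) -> 0 < \sum_(i < d.+1) b i -> measurable A ->
  dirichlet_face b A = dirichlet_prob b A.
Proof.
move=> b0 bs mA.
case sE : [seq i <- enum 'I_d.+1 | 0 < b i] => [|i0 s'].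
  move: bs; rewrite big1 ?ltxx// => i _; apply/eqP; rewrite eq_le b0 andbT leNgt.
  by apply/negP => bi; have : i \in [::] by rewrite -sE mem_filter bi mem_enum.
have mfe := @measurable_face_embed d i0 s'.
have mAf : measurable (@face_embed R d (size s').+1 (i0 :: s') @^-1` A).
  by rewrite -[X in measurable X]setTI; exact: mfe.
have c0 := face_param_gt0 sE.
have <- : dirichlet (fun j : 'I_(size s').+1 => b (nth i0 (i0 :: s') j))
    (face_embed (i0 :: s') @^-1` A) = dirichlet_prob b A.
  rewrite (dirichletE c0 mAf).
  have m1A : measurable_fun setT (fun y : d.+1.-tuple R => (\1_A y)%:E : \bar R).
    by apply/measurable_EFinP.
  have i1A (y : d.+1.-tuple R) : (0 <= (\1_A y : R)%:E)%E by rewrite lee_fin.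
  transitivity (\int[dirichlet_prob b]_x (\1_A x)%:E)%E; last first.
    by rewrite integral_indic// setIT.
  rewrite (ge0_integral_dirichlet_prob_face b0 sE m1A i1A).
  transitivity (\int[dirichlet_prob (fun j : 'I_(size s').+1 => b (nth i0 (i0 :: s') j))]_x
      (\1_(face_embed (i0 :: s') @^-1` A) x)%:E)%E.
    by rewrite integral_indic ?setIT.
  by apply: eq_integral => y _; rewrite !indicE.
(* With two or more positive indices the definition is literally the left side; only the singleton
   remains. *)
rewrite /dirichlet_face sE; case: s' sE mfe mAf c0 => [|i1 s'] sE mfe mAf c0 //.
rewrite (dirichletE c0 mAf) dirichlet_prob1// !diracE; congr (_%:R%:E).
have <- : face_embed [:: i0] [tuple 1 : R] = vertex i0.
  apply: eq_from_tnth => i; rewrite !tnth_mktuple /= eq_sym.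
  by case: eqVneq.
by [].
Qed.

End faces.
(** * Convolution and mixtures *)

Section convolution.
Context {R : realType}.

Lemma simplex_sum d (x : d.+1.-tuple R) : simplex x -> sum_tuple x = 1.
Proof. by case. Qed.

(** The law is carried by the simplex: almost surely the gamma vector is nonnegative with a positive
    coordinate, so its mass is positive and dividing by it is genuine. *)
Lemma ge0_eq_integral_dirichlet_prob d (b : 'I_d.+1 -> R) (f g : d.+1.-tuple R -> \bar R) :
  (forall i, 0 <= b i) -> 0 < \sum_(i < d.+1) b i ->
  measurable_fun setT f -> (forall y, (0 <= f y)%E) ->
  measurable_fun setT g -> (forall y, (0 <= g y)%E) ->
  (forall x, simplex x -> f x = g x) ->
  (\int[dirichlet_prob b]_x f x = \int[dirichlet_prob b]_x g x)%E.
Proof.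
move=> b0 bs mf f0 mg g0 fg.
have mn := @measurable_normalize_tuple R d.+1.
rewrite (ge0_integral_dirichlet_prob b mf f0) (ge0_integral_dirichlet_prob b mg g0).
apply: (ge0_eq_integral_gamma_tuple b0 (measurableT_comp mf mn) (fun=> f0 _)
  (measurableT_comp mg mn) (fun=> g0 _)) => y y0 by0; apply: fg.
have [i bi] : exists i, 0 < b i.
  apply/existsP; rewrite -[X in is_true X]negbK negb_exists; apply/negP => /forallP bn.
  by move: bs; rewrite big1 ?ltxx// => i _; apply/eqP; rewrite eq_le b0 leNgt bn.
have sy : 0 < sum_tuple y.
  by rewrite /sum_tuple (bigD1 i)//= ltr_pwDl ?by0// sumr_ge0.
split=> [j|]; first by rewrite tnth_mktuple mulr_ge0// powR_ge0.
have := @sum_scale_tuple R _ (sum_tuple y `^ (-1)) y.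
by rewrite powR_inv1 ?ltW// mulVf ?gt_eqF// /sum_tuple => <-; rewrite -powR_inv1 ?ltW.
Qed.

(** The last coordinate of the corresponding Dirichlet law has law beta(q, p). *)
Definition pair_param (p q : R) (i : 'I_2) : R := if i == ord0 then p else q.

Lemma pair_param_gt0 p q : 0 < p -> 0 < q -> forall i, 0 < pair_param p q i.
Proof. by move=> p0 q0 i; rewrite /pair_param; case: ifP. Qed.

Lemma sum_pair_param p q : \sum_(i < 2) pair_param p q i = p + q.
Proof. by rewrite !big_ord_recl big_ord0 addr0. Qed.

Lemma gamma_prob_polar (p q : R) (h : R -> R -> \bar R) : 0 < p -> 0 < q ->
  measurable_fun setT (fun z : R * R => h z.1 z.2) -> (forall u v, (0 <= h u v)%E) ->
  (\int[gamma_prob p]_u \int[gamma_prob q]_v h u v =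
   \int[gamma_prob (p + q)]_r \int[dirichlet_prob (pair_param p q)]_x
     h (r * tnth x ord0)%R (r * tnth x ord_max)%R)%E.
Proof.
move=> p0 q0 mh h0; have b0 := pair_param_gt0 p0 q0.
pose H (y : 2.-tuple R) := h (tnth y ord0) (tnth y ord_max).
have mH : measurable_fun setT H.
  apply: (measurableT_comp mh (g := fun y : 2.-tuple R => (tnth y ord0, tnth y ord_max))).
  by apply/measurable_fun_pair => /=; exact: measurable_tnth.
have H0 y : (0 <= H y)%E by exact: h0.
transitivity (\int[gamma_tuple (pair_param p q)]_y H y)%E; last first.
  have HP := gamma_tuple_polar_gt0 b0 mH H0.
  apply: (etrans HP).
  rewrite sum_pair_param.
  apply: eq_integral => r _.
  by apply: eq_integral => x _; rewrite /H !tnth_mktuple.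
rewrite (ge0_integral_gamma_tupleS (pair_param p q) mH H0).
apply: eq_integral => u _; have mHu := measurable_slice u mH.
rewrite [RHS](ge0_integral_gamma_tupleS _ mHu (fun=> H0 _)).
apply: eq_integral => v _; have mHuv := measurable_slice v mHu.
by rewrite (ge0_integral_gamma_tuple0 _ mHuv).
Qed.

(** For positive parameters this is the polar decomposition in dimension two, where r w_0 + r w_1 =
    r; a zero parameter adds the constant 0. *)
Lemma gamma_prob_conv (p q : R) (h : R -> \bar R) : 0 <= p -> 0 <= q ->
  measurable_fun setT h -> (forall u, (0 <= h u)%E) ->
  (\int[gamma_prob (p + q)]_u h u =
   \int[gamma_prob p]_u \int[gamma_prob q]_v h (u + v)%R)%E.
Proof.
move=> p0 q0 mh h0.
have mhD : measurable_fun (setT : set (measurableTypeR R * measurableTypeR R))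
    (fun z => h (z.1 + z.2)).
  by apply: (measurableT_comp mh); exact: measurable_funD.
have mhu u : measurable_fun (setT : set (measurableTypeR R)) (fun v => h (u + v)).
  by apply: (measurableT_comp mh); exact: measurable_funD.
have mhI : measurable_fun (setT : set (measurableTypeR R))
    (fun u => \int[gamma_prob q]_v h (u + v)%R)%E.
  exact: (measurable_fun_ge0_integral (gamma_prob q) mhD).
move: p0; rewrite le_eqVlt => /predU1P[<-|p0].
  apply/esym; apply: (etrans (ge0_integral_gamma_prob0 mhI)).
  by rewrite add0r; apply: eq_integral => v _; rewrite add0r.
move: q0; rewrite le_eqVlt => /predU1P[<-|q0].
  rewrite addr0; apply: eq_integral => u _.
  by apply/esym; apply: (etrans (ge0_integral_gamma_prob0 (mhu u))); rewrite addr0.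
apply/esym; apply: (etrans (gamma_prob_polar p0 q0 mhD (fun _ _ => h0 _))).
apply: eq_integral => r _.
rewrite -[RHS](ge0_integral_prob_cst (dirichlet_prob (pair_param p q))).
apply: ge0_eq_integral_dirichlet_prob => //.
- by move=> i; apply: ltW; exact: pair_param_gt0.
- by rewrite sum_pair_param addr_gt0.
- apply: (measurableT_comp mh); apply: measurable_funD; apply: measurable_funM => //;
    exact: measurable_tnth.
move=> x /simplex_sum; rewrite /sum_tuple !big_ord_recl big_ord0 addr0 => x1.
by rewrite -mulrDr -[in RHS](mulr1 r) -x1; congr (h (_ * (_ + tnth x _))); exact: val_inj.
Qed.

Lemma gamma_tuple_conv n (a b : 'I_n -> R) (h : n.-tuple R -> \bar R) :
  (forall i, 0 <= a i) -> (forall i, 0 <= b i) ->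
  measurable_fun setT h -> (forall y, (0 <= h y)%E) ->
  (\int[gamma_tuple (fun i => a i + b i)%R]_y h y =
   \int[gamma_tuple a]_y \int[gamma_tuple b]_z h (add_tuple y z))%E.
Proof.
elim: n a b h => [|n IH] a b h a0 b0 mh h0.
  have mhy (y : 0.-tuple R) : measurable_fun setT (fun z => h (add_tuple y z)).
    by apply: (measurableT_comp mh); exact: measurable_add_tuple.
  have mhz : measurable_fun setT (fun y => \int[gamma_tuple b]_z h (add_tuple y z))%E.
    under eq_fun do rewrite (ge0_integral_gamma_tuple0 b (mhy _)).
    by apply: (measurableT_comp mh); exact: measurable_add_tuple.
  rewrite (ge0_integral_gamma_tuple0 _ mh) (ge0_integral_gamma_tuple0 _ mhz).
  rewrite (ge0_integral_gamma_tuple0 _ (mhy _)).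
  by congr h; apply: eq_from_tnth => -[].
have mhc dd (T : measurableType dd) (f g : T -> R) (y z : T -> n.-tuple R) :
    measurable_fun setT f -> measurable_fun setT g ->
    measurable_fun setT y -> measurable_fun setT z ->
    measurable_fun setT (fun w => h (cons_pair (f w + g w, add_tuple (y w) (z w)))).
  move=> mf mg my mz; apply: (measurableT_comp mh); apply: measurable_cons_pair_comp.
    exact: measurable_funD.
  exact: measurable_add_tuple.
have mha : measurable_fun setT (fun w : n.+1.-tuple R * n.+1.-tuple R =>
    h (add_tuple w.1 w.2)).
  by apply: (measurableT_comp mh); exact: measurable_add_tuple.
have mhI : measurable_fun setT (fun y => \int[gamma_tuple b]_z h (add_tuple y z))%E.
  exact: (measurable_fun_ge0_integral (gamma_tuple b) mha).
pose a' i := a (lift ord0 i); pose b' i := b (lift ord0 i).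
have mhi : measurable_fun (setT : set (measurableTypeR R))
    (fun x => \int[gamma_tuple (fun i => a' i + b' i)%R]_t h (cons_pair (x, t)))%E.
  exact: measurable_integral_slice.
have hi0 (x : R) :
    (0 <= \int[gamma_tuple (fun i => a' i + b' i)%R]_t h (cons_pair (x, t)))%E.
  exact: integral_ge0.
apply: (etrans (ge0_integral_gamma_tupleS _ mh h0)).
apply: (etrans (gamma_prob_conv (a0 _) (b0 _) mhi hi0)).
apply/esym; apply: (etrans (ge0_integral_gamma_tupleS a mhI _)).
  by move=> y; exact: integral_ge0.
apply: eq_integral => u _; apply/esym.
transitivity (\int[gamma_prob (b ord0)]_v \int[gamma_tuple a']_t \int[gamma_tuple b']_w
    h (cons_pair (u + v, add_tuple t w)%R))%E.
  apply: eq_integral => v _.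
  exact: (IH a' b' (fun t => h (cons_pair (u + v, t))) (fun=> a0 _) (fun=> b0 _)
    (measurable_slice _ mh) (fun=> h0 _)).
pose f v t := (\int[gamma_tuple b']_w h (cons_pair (u + v, add_tuple t w)%R))%E.
have mf : measurable_fun (setT : set (measurableTypeR R * n.-tuple R))
    (fun p => f p.1 p.2).
  apply: (measurable_fun_ge0_integral (T1 := (measurableTypeR R * n.-tuple R)%type)).
    by apply: mhc; [exact: measurable_cst|exact: measurableT_comp|
      exact: measurableT_comp|exact: measurable_snd].
  by move=> *; exact: h0.
have f0 v t : (0 <= f v t)%E by exact: integral_ge0.
apply: (etrans (ge0_integral_swap (gamma_prob (b ord0)) (gamma_tuple a') mf f0)).
apply: eq_integral => t _; apply/esym.
have mht : measurable_fun setT (fun z => h (add_tuple (cons_pair (u, t)) z)).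
  by apply: (measurableT_comp mh); exact: measurable_add_tuple.
apply: (etrans (ge0_integral_gamma_tupleS _ mht (fun=> h0 _))).
by apply: eq_integral => v _; apply: eq_integral => w _; rewrite add_cons_pair.
Qed.

End convolution.

(** * Mixtures of two Dirichlet laws *)

Section mixture.
Context {R : realType}.

Lemma mixE d (y : R) (x z : d.+1.-tuple R) :
  mix y x z = add_tuple (scale_tuple (1 - y) x) (scale_tuple y z).
Proof. by apply: eq_from_tnth => i; rewrite !tnth_mktuple. Qed.

Lemma sum_add_tuple n (y z : n.-tuple R) :
  sum_tuple (add_tuple y z) = sum_tuple y + sum_tuple z.
Proof. by rewrite /sum_tuple -big_split/=; apply: eq_bigr => i _; rewrite tnth_mktuple. Qed.

Lemma sum_mix d (y : R) (x z : d.+1.-tuple R) :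
  sum_tuple x = 1 -> sum_tuple z = 1 -> sum_tuple (mix y x z) = 1.
Proof. by move=> x1 z1; rewrite mixE sum_add_tuple !sum_scale_tuple x1 z1; ring. Qed.

Lemma measurable_mix dd (T : measurableType dd) d (y : T -> R) (x z : T -> d.+1.-tuple R) :
  measurable_fun setT y -> measurable_fun setT x -> measurable_fun setT z ->
  measurable_fun setT (fun w => mix (y w) (x w) (z w)).
Proof.
move=> my mx mz; under eq_fun do rewrite mixE.
apply: measurable_add_tuple; apply: measurable_scale_tuple => //.
exact: measurable_funB.
Qed.

(* If G and H are vectors of independent gamma variables with parameters a and b,
   then G + H is again gamma with parameter a + b, and its direction is the mixture
   of the directions of G and H with weight |H| / (|G| + |H|); polar coordinates
   make all these quantities independent. *)
Lemma dirichlet_prob_mix d (a b : 'I_d.+1 -> R) (g : d.+1.-tuple R -> \bar R) :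
  (forall i, 0 <= a i) -> 0 < \sum_(i < d.+1) a i ->
  (forall i, 0 <= b i) -> 0 < \sum_(i < d.+1) b i ->
  measurable_fun setT g -> (forall y, (0 <= g y)%E) ->
  (\int[dirichlet_prob a]_x \int[dirichlet_prob b]_z
     \int[dirichlet_prob (pair_param (\sum_(i < d.+1) a i) (\sum_(i < d.+1) b i))]_w
       g (mix (tnth w ord_max) x z) =
   \int[dirichlet_prob (fun i => a i + b i)%R]_x g x)%E.
Proof.
move=> a0 as0 b0 bs0 mg g0.
set sa := \sum_(i < d.+1) a i in as0 *; set sb := \sum_(i < d.+1) b i in bs0 *.
pose G y := g (normalize_tuple y).
have mG : measurable_fun setT G := measurableT_comp mg (@measurable_normalize_tuple R d.+1).
have G0 y : (0 <= G y)%E by exact: g0.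
(* [K s x t z] is [g] at the direction of the sum of two vectors with masses [s], [t] and directions
   [x], [z]. *)
pose K s x t z := G (add_tuple (scale_tuple s x) (scale_tuple t z)).
have K0 s x t z : (0 <= K s x t z)%E by exact: G0.
have mK dd (T : measurableType dd) (s t : T -> R) (x z : T -> d.+1.-tuple R) :
    measurable_fun setT s -> measurable_fun setT x ->
    measurable_fun setT t -> measurable_fun setT z ->
    measurable_fun setT (fun p => K (s p) (x p) (t p) (z p)).
  move=> ms mx mt mz; apply: (measurableT_comp mG).
  by apply: measurable_add_tuple; exact: measurable_scale_tuple.
pose U := d.+1.-tuple R; pose V := measurableTypeR R.
apply/esym; apply: (etrans (ge0_integral_dirichlet_prob _ mg g0)).
apply: (etrans (gamma_tuple_conv a0 b0 mG G0)).
have mGa : measurable_fun (setT : set (U * U)) (fun p => G (add_tuple p.1 p.2)).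
  by apply: (measurableT_comp mG); exact: measurable_add_tuple.
have mGI : measurable_fun (setT : set U)
    (fun y => \int[gamma_tuple b]_z G (add_tuple y z))%E.
  exact: (measurable_fun_ge0_integral (gamma_tuple b) mGa).
apply: (etrans (gamma_tuple_polar a0 as0 mGI _)).
  by move=> y; exact: integral_ge0.
transitivity (\int[gamma_prob sa]_s \int[dirichlet_prob a]_x
    \int[gamma_prob sb]_t \int[dirichlet_prob b]_z K s x t z)%E.
  apply: eq_integral => s _; apply: eq_integral => x _.
  have mGs : measurable_fun setT (fun z => G (add_tuple (scale_tuple s x) z)).
    by apply: (measurableT_comp mG); exact: measurable_add_tuple.
  exact: (gamma_tuple_polar b0 bs0 mGs (fun=> G0 _)).
have m4 : measurable_fun (setT : set (((V * U) * V) * U))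
    (fun p => K p.1.1.1 p.1.1.2 p.1.2 p.2).
  apply: mK.
  - by do 2 apply: measurableT_comp => //.
  - by do 2 apply: measurableT_comp => //.
  - by apply: measurableT_comp.
  - exact: measurable_snd.
have m3 : measurable_fun (setT : set ((V * U) * V))
    (fun p => \int[dirichlet_prob b]_z K p.1.1 p.1.2 p.2 z)%E.
  exact: (measurable_fun_ge0_integral (dirichlet_prob b)
    (f := fun p z => K p.1.1 p.1.2 p.2 z) m4).
have m2 : measurable_fun (setT : set (V * U))
    (fun p => \int[gamma_prob sb]_t \int[dirichlet_prob b]_z K p.1 p.2 t z)%E.
  apply: (measurable_fun_ge0_integral (gamma_prob sb)
    (f := fun p t => \int[dirichlet_prob b]_z K p.1 p.2 t z)%E m3).
  by move=> p t; exact: integral_ge0.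
apply: (etrans (ge0_integral_swap (gamma_prob sa) (dirichlet_prob a)
  (f := fun s x => \int[gamma_prob sb]_t \int[dirichlet_prob b]_z K s x t z)%E m2 _)).
  by move=> s x; apply: integral_ge0 => t _; exact: integral_ge0.
transitivity (\int[dirichlet_prob a]_x \int[dirichlet_prob b]_z
    \int[gamma_prob sa]_s \int[gamma_prob sb]_t K s x t z)%E.
  apply: eq_integral => x _.
  transitivity (\int[gamma_prob sa]_s \int[dirichlet_prob b]_z
    \int[gamma_prob sb]_t K s x t z)%E.
    apply: eq_integral => s _.
    have mtz : measurable_fun (setT : set (V * U)) (fun p => K s x p.1 p.2).
      by apply: mK.
    exact: (ge0_integral_swap (gamma_prob sb) (dirichlet_prob b)
      (f := fun t z => K s x t z) mtz).
  have mszt : measurable_fun (setT : set ((V * U) * V)) (fun p => K p.1.1 x p.2 p.1.2).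
    by apply: mK => //; apply: measurableT_comp.
  have msz : measurable_fun (setT : set (V * U))
      (fun p => \int[gamma_prob sb]_t K p.1 x t p.2)%E.
    exact: (measurable_fun_ge0_integral (gamma_prob sb)
      (f := fun p t => K p.1 x t p.2) mszt).
  apply: (ge0_integral_swap (gamma_prob sa) (dirichlet_prob b)
    (f := fun s z => \int[gamma_prob sb]_t K s x t z)%E msz).
  by move=> s z; exact: integral_ge0.
pose W := 2.-tuple R; set pw := dirichlet_prob (pair_param sa sb).
(* With the directions outermost, the two masses are replaced by their sum [r] and their proportions
   [w]. *)
transitivity (\int[dirichlet_prob a]_x \int[dirichlet_prob b]_z
    \int[gamma_prob (sa + sb)]_r \int[pw]_w K (r * tnth w ord0)%R x (r * tnth w ord_max)%R z)%E.
  apply: eq_integral => x _; apply: eq_integral => z _.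
  have mst : measurable_fun (setT : set (V * V)) (fun p => K p.1 x p.2 z).
    by apply: mK.
  exact: (gamma_prob_polar as0 bs0 mst (fun _ _ => K0 _ _ _ _)).
have mw (i : 'I_2) : measurable_fun setT (fun w : 2.-tuple R => tnth w i).
  exact: measurable_tnth.
have mrw dd (T : measurableType dd) (r : T -> R) (w : T -> 2.-tuple R) (i : 'I_2) :
    measurable_fun setT r -> measurable_fun setT w ->
    measurable_fun setT (fun p => r p * tnth (w p) i).
  move=> mr mw'; apply: measurable_funM => //; exact: measurable_fun_tnth.
pose L x z r := (\int[pw]_w K (r * tnth w ord0)%R x (r * tnth w ord_max)%R z)%E.
have L0 x z r : (0 <= L x z r)%E by exact: integral_ge0.
have mL : measurable_fun (setT : set ((U * U) * V)) (fun p => L p.1.1 p.1.2 p.2).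
  apply: (measurable_fun_ge0_integral pw (f := fun (p : (U * U) * V) w =>
    K (p.2 * tnth w ord0) p.1.1 (p.2 * tnth w ord_max) p.1.2)) => //.
  by apply: mK; [apply: mrw|do 2 apply: measurableT_comp => //|apply: mrw|
    do 2 apply: measurableT_comp => //] => //; exact: measurableT_comp.
have mLr : measurable_fun (setT : set (U * U))
    (fun p => \int[gamma_prob (sa + sb)]_r L p.1 p.2 r)%E.
  exact: (measurable_fun_ge0_integral (gamma_prob (sa + sb))
    (f := fun p r => L p.1 p.2 r) mL).
have mLz : measurable_fun (setT : set U)
    (fun x => \int[dirichlet_prob b]_z \int[gamma_prob (sa + sb)]_r L x z r)%E.
  apply: (measurable_fun_ge0_integral (dirichlet_prob b)
    (f := fun x z => \int[gamma_prob (sa + sb)]_r L x z r)%E mLr).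
  by move=> x z; exact: integral_ge0.
pose M x z := (\int[pw]_w g (mix (tnth w ord_max) x z))%E.
have M0 x z : (0 <= M x z)%E by exact: integral_ge0.
have mM : measurable_fun (setT : set (U * U)) (fun p => M p.1 p.2).
  apply: (measurable_fun_ge0_integral pw
    (f := fun p w => g (mix (tnth w ord_max) p.1 p.2))) => //.
  apply: (measurableT_comp mg); apply: measurable_mix; last 2 first.
  - by apply: measurableT_comp.
  - by apply: measurableT_comp.
  by apply: (measurableT_comp (mw ord_max)).
have mMz : measurable_fun (setT : set U) (fun x => \int[dirichlet_prob b]_z M x z)%E.
  exact: (measurable_fun_ge0_integral (dirichlet_prob b) (f := M) mM).
have slice (f : U -> U -> \bar R) x : measurable_fun (setT : set (U * U))
    (fun p => f p.1 p.2) -> measurable_fun setT (f x).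
  by move=> mf; exact: (measurableT_comp mf (measurable_pair1 x)).
apply: (ge0_eq_integral_dirichlet_prob a0 as0 mLz _ mMz).
- by move=> x; apply: integral_ge0 => z _; exact: integral_ge0.
- by move=> x; exact: integral_ge0.
move=> x /simplex_sum x1.
apply: (ge0_eq_integral_dirichlet_prob b0 bs0 (slice
  (fun x z => \int[gamma_prob (sa + sb)]_r L x z r)%E x mLr) _ (slice M x mM)).
- by move=> z; exact: integral_ge0.
- by move=> z; exact: M0.
move=> z /simplex_sum z1.
rewrite -[RHS](ge0_integral_prob_cst (gamma_prob (sa + sb))).
have mLxz : measurable_fun (setT : set V) (L x z).
  exact: (measurableT_comp mL (measurable_pair1 (x, z))).
have sab0 : 0 < sa + sb by exact: addr_gt0.
apply: (ge0_eq_integral_gamma_prob (ltW sab0) mLxz (L0 x z) (measurable_cst _)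
  (fun=> M0 _ _)) => r _ /(_ sab0) r0.
have pp0 i : 0 <= pair_param sa sb i by exact/ltW/pair_param_gt0.
have spp0 : 0 < \sum_(i < 2) pair_param sa sb i by rewrite sum_pair_param.
have mKw : measurable_fun setT
    (fun w : 2.-tuple R => K (r * tnth w ord0) x (r * tnth w ord_max) z).
  by apply: mK => //; apply: mrw.
have mgw : measurable_fun setT (fun w : 2.-tuple R => g (mix (tnth w ord_max) x z)).
  by apply: (measurableT_comp mg); apply: measurable_mix.
apply: (ge0_eq_integral_dirichlet_prob pp0 spp0 mKw (fun=> K0 _ _ _ _) mgw
  (fun=> g0 _)) => w /simplex_sum.
rewrite /sum_tuple !big_ord_recl big_ord0 addr0 => w1.
(* The vector r w_0 x + r w_1 z is [r] times the mixture, which has sum 1, so normalizing removes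
   [r]. *)
rewrite /K /G; congr g; rewrite -[RHS](normalize_scale_tuple r0 (sum_mix _ x1 z1)).
congr normalize_tuple; rewrite mixE.
apply: eq_from_tnth => i; rewrite !tnth_mktuple.
have <- : tnth w ord0 = 1 - tnth w ord_max.
  by rewrite -w1 (_ : lift ord0 ord0 = ord_max) ?addrK//; exact: val_inj.
by ring.
Qed.

End mixture.

(** * Multinomial theorem and the Dirichlet law as a mixture *)

Section multinomial.
Context {R : realType}.

(** Truncation at degree [k] keeps product coefficients up to [k] exact, and its k + 1 terms match
    the range ['I_k.+1] of the multi-indices. *)
Definition trunc_exp (k : nat) (x : R) : {poly R} := \poly_(j < k.+1) (x ^+ j / j`!%:R).

Lemma fact_neq0 n : n`!%:R != 0 :> R.
Proof. by rewrite pnatr_eq0 -lt0n fact_gt0. Qed.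

(** The product rule for exponentials, read at degree j; the induction step is the binomial
    theorem. *)
Lemma coef_prod_trunc_exp k n (x : 'I_n -> R) j : (j <= k)%N ->
  (\prod_(i < n) trunc_exp k (x i))`_j = (\sum_(i < n) x i) ^+ j / j`!%:R.
Proof.
elim: n x j => [|n IH] x j jk.
  by rewrite !big_ord0 coef1 expr0n; case: j {jk} => [|j]; rewrite ?mul0r// fact0 divr1.
rewrite !big_ord_recl coefM addrC exprDn mulr_suml; apply: eq_bigr => i _.
have ij : (i <= j)%N by rewrite -ltnS.
rewrite IH ?(leq_trans (leq_subr _ _))// coef_poly ltnS (leq_trans ij)//.
rewrite -(bin_fact ij) !natrM -[in RHS]mulr_natr.
have := fact_neq0 i; have := fact_neq0 (j - i).
have : 'C(j, i)%:R != 0 :> R by rewrite pnatr_eq0 -lt0n bin_gt0.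
by move=> *; field; apply/and3P.
Qed.

(* Both sides are the coefficient of X^k in the product of the truncated exponential
   series of the x i. *)
Lemma multinomial k n (x : 'I_n -> R) :
  \sum_(b : {ffun 'I_n -> 'I_k.+1} | (\sum_(i < n) b i == k)%N)
    \prod_(i < n) (x i ^+ b i / (b i)`!%:R) = (\sum_(i < n) x i) ^+ k / k`!%:R.
Proof.
rewrite -(coef_prod_trunc_exp x (leqnn k)) /trunc_exp.
under [in RHS]eq_bigr do rewrite poly_def.
rewrite bigA_distr_bigA/= coef_sum big_mkcond/=; apply: eq_bigr => b _.
under [in RHS]eq_bigr do rewrite -mul_polyC.
rewrite [in RHS]big_split/= -(rmorph_prod (@polyC R))/= prodrXr coefCM coefXn eq_sym.
by case: eqP; rewrite ?mulr1 ?mulr0.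
Qed.

End multinomial.

Section dirichlet_mixture.
Context {R : realType}.

Definition bernoulli_weight d k (a : 'I_d.+1 -> R) (b : {ffun 'I_d.+1 -> 'I_k.+1}) : R :=
  k`!%:R / rising (\sum_(i < d.+1) a i) k * \prod_(i < d.+1) (rising (a i) (b i) / (b i)`!%:R).

Lemma rising_gt0 (c : R) n : 0 < c -> 0 < rising c n.
Proof. by move=> c0; apply: prodr_gt0 => i _; rewrite ltr_pwDl. Qed.

Lemma bernoulli_weight_ge0 d k (a : 'I_d.+1 -> R) b : (forall i, 0 < a i) ->
  0 <= @bernoulli_weight d k a b.
Proof.
move=> a0; apply: mulr_ge0.
  by rewrite divr_ge0// ltW// rising_gt0// sum_gt0.
by apply: prodr_ge0 => i _; rewrite divr_ge0// ltW// rising_gt0.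
Qed.

(** The rule (c)_n Gamma(c) = Gamma(c + n) turns the constants of D(a + b) into those of D(a),
    leaving the monomial y^b / b!. It is pointwise in all [y], since both sides share the same
    cut-offs. *)
Lemma bernoulli_weight_pdf d k (a : 'I_d.+1 -> R) (b : {ffun 'I_d.+1 -> 'I_k.+1})
    (y : d.+1.-tuple R) : (forall i, 0 < a i) -> (\sum_(i < d.+1) b i == k)%N ->
  bernoulli_weight a b * simplex_pdf (fun i => a i + (b i)%:R) y =
  simplex_pdf a y * (k`!%:R * \prod_(i < d.+1) (tnth y i ^+ b i / (b i)`!%:R)).
Proof.
move=> a0 /eqP bk; have as0 := sum_gt0 a0.
have Sab : \sum_(i < d.+1) (a i + (b i)%:R) = \sum_(i < d.+1) a i + k%:R.
  by rewrite big_split/= -natr_sum bk.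
rewrite /bernoulli_weight /simplex_pdf Sab -rising_Gamma//.
have E i : rising (a i) (b i) / (b i)`!%:R *
    ((Gamma (a i + (b i)%:R))^-1 * pos_powR (a i + (b i)%:R - 1) (tnth y i)) =
    ((Gamma (a i))^-1 * pos_powR (a i - 1) (tnth y i)) * (tnth y i ^+ b i / (b i)`!%:R).
  rewrite -rising_Gamma// /pos_powR; case: ifP => y0; last by rewrite !(mulr0, mul0r).
  have -> : tnth y i `^ (a i + (b i)%:R - 1) = tnth y i `^ (a i - 1) * tnth y i ^+ b i.
    rewrite -powR_mulrn ?ltW// -powRD ?(gt_eqF y0) ?implybT//.
    by congr (_ `^ _); ring.
  have := fact_neq0 (R := R) (b i); have := rising_gt0 (b i) (a0 i).
  have := Gamma_gt0 (a0 i) => /lt0r_neq0 ? /lt0r_neq0 ? ?.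
  by field; apply/and3P.
have := rising_gt0 k as0 => /lt0r_neq0 r0.
transitivity (k`!%:R * Gamma (\sum_(i < d.+1) a i) *
  (\prod_(i < d.+1) (rising (a i) (b i) / (b i)`!%:R) *
  \prod_(i < d.+1) ((Gamma (a i + (b i)%:R))^-1 * pos_powR (a i + (b i)%:R - 1) (tnth y i)))).
  by field.
have -> : \prod_(i < d.+1) (rising (a i) (b i) / (b i)`!%:R) *
  \prod_(i < d.+1) ((Gamma (a i + (b i)%:R))^-1 * pos_powR (a i + (b i)%:R - 1) (tnth y i)) =
  \prod_(i < d.+1) ((Gamma (a i))^-1 * pos_powR (a i - 1) (tnth y i)) *
  \prod_(i < d.+1) (tnth y i ^+ b i / (b i)`!%:R).
  by rewrite -[LHS]big_split -[RHS]big_split/=; apply: eq_bigr => i _; exact: E.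
ring.
Qed.

Lemma dirichlet_prob_mixture d k (a : 'I_d.+1 -> R) (g : d.+1.-tuple R -> \bar R) :
  (forall i, 0 < a i) -> measurable_fun setT g -> (forall y, (0 <= g y)%E) ->
  (\sum_(b : {ffun 'I_d.+1 -> 'I_k.+1} | (\sum_(i < d.+1) b i == k)%N)
     (bernoulli_weight a b)%:E * \int[dirichlet_prob (fun i => a i + (b i)%:R)%R]_x g x =
   \int[dirichlet_prob a]_x g x)%E.
Proof.
move=> a0 mg g0.
have ab0 (b : {ffun 'I_d.+1 -> 'I_k.+1}) i : 0 < a i + (b i)%:R by rewrite ltr_pwDl.
have mq c : measurable_fun setT
    (fun x : d.-tuple R => g (complete_coord x) * (simplex_pdf c (complete_coord x))%:E)%E.
  apply: emeasurable_funM; first exact: (measurableT_comp mg (@measurable_complete_coord R d)).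
  apply/measurable_EFinP.
  exact: (measurableT_comp (measurable_simplex_pdf c) (@measurable_complete_coord R d)).
apply/esym; apply: (etrans (ge0_integral_dirichlet_prob_pdf a0 mg g0)); apply/esym.
transitivity (\sum_(b : {ffun 'I_d.+1 -> 'I_k.+1} | (\sum_(i < d.+1) b i == k)%N)
  \int[lebesgue_tuple d]_x ((bernoulli_weight a b)%:E * (g (complete_coord x) *
    (simplex_pdf (fun i => a i + (b i)%:R)%R (complete_coord x))%:E)))%E.
  apply: eq_bigr => b _.
  have q0 (x : d.-tuple R) : (0 <= g (complete_coord x) *
      (simplex_pdf (fun i => a i + (b i)%:R)%R (complete_coord x))%:E)%E.
    by rewrite mule_ge0// lee_fin simplex_pdf_ge0.
  have w0 : (0 <= (bernoulli_weight a b)%:E)%E by rewrite lee_fin bernoulli_weight_ge0.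
  rewrite (ge0_integralZl (lebesgue_tuple d) measurableT (mq _) (fun x _ => q0 x) w0).
  by congr (_ * _)%E; exact: (ge0_integral_dirichlet_prob_pdf (ab0 b) mg g0).
(* The condition on [b] moves into the index list, the form in which sum and integral are
   exchanged. *)
rewrite -big_filter -ge0_integral_sum//; last 2 first.
- by move=> b; apply: emeasurable_funM => //; exact: mq.
- by move=> b x _; rewrite !mule_ge0// lee_fin ?bernoulli_weight_ge0 ?simplex_pdf_ge0.
apply: eq_integral => x _ /=; rewrite big_filter.
under eq_bigr => b bk.
  rewrite muleCA -EFinM (bernoulli_weight_pdf _ a0 bk).
  over.
rewrite /= -ge0_sume_distrr; last first.
  move=> b bk; rewrite lee_fin -(bernoulli_weight_pdf _ a0 bk) mulr_ge0//.
    exact: bernoulli_weight_ge0.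
  exact: simplex_pdf_ge0.
(* The monomials add up to the k-th power of the sum of the barycentric coordinates, which is 1. *)
rewrite sumEFin -!mulr_sumr (multinomial k (fun i => tnth (complete_coord x) i)).
have -> : \sum_(i < d.+1) tnth (complete_coord x) i = 1 by exact: sum_complete_coord.
by rewrite expr1n mul1r divff ?fact_neq0// mulr1.
Qed.

End dirichlet_mixture.

(** * The transform of a Dirichlet law at its total parameter *)

Section dirichlet_transform.
Context {R : realType}.

Definition dot_tuple n (f : 'I_n -> R) (x : n.-tuple R) : R := \sum_(i < n) f i * tnth x i.

Lemma measurable_dot_tuple dd (T : measurableType dd) n (f : 'I_n -> R) (x : T -> n.-tuple R) :
  measurable_fun setT x -> measurable_fun setT (fun w => dot_tuple f (x w)).
Proof.
move=> mx; apply: measurable_sum => i; apply: measurable_funM => //.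
exact: measurable_fun_tnth.
Qed.

Lemma dot_tuple_gt0 d (f : 'I_d.+1 -> R) (x : d.+1.-tuple R) :
  (forall i, 0 < f i) -> simplex x -> 0 < dot_tuple f x.
Proof.
move=> f0 [x0 x1]; have [i xi] : exists i, 0 < tnth x i.
  apply/existsP; rewrite -[X in is_true X]negbK negb_exists; apply/negP => /forallP xn.
  have /eqP := x1; rewrite big1 ?(eq_sym 0) ?oner_eq0// => i _.
  by apply/eqP; rewrite eq_le x0 leNgt xn.
rewrite /dot_tuple (bigD1 i)//= ltr_pwDl ?mulr_gt0// sumr_ge0// => j _.
by rewrite mulr_ge0// ltW.
Qed.

(** For [x] in the simplex, the sum of the (f_i - 1) x_i is <f, x> - 1. Integrating out the mass,
    gamma of parameter |b|, in the Laplace transform thus leaves <f, x>^(-|b|). *)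
Lemma dirichlet_prob_transform d (b f : 'I_d.+1 -> R) :
  (forall i, 0 <= b i) -> 0 < \sum_(i < d.+1) b i -> (forall i, 0 < f i) ->
  (\int[dirichlet_prob b]_x (dot_tuple f x `^ (- \sum_(i < d.+1) b i))%:E =
   (\prod_(i < d.+1) f i `^ (- b i))%:E)%E.
Proof.
move=> b0 bs0 f0; set sb := \sum_(i < d.+1) b i in bs0 *.
pose U := d.+1.-tuple R; pose V := measurableTypeR R.
rewrite -(gamma_tuple_laplace b0 f0).
pose h (y : U) := (expR (- dot_tuple (fun i => f i - 1) y))%:E.
have mh : measurable_fun setT h.
  apply/measurable_EFinP; do 2 apply: measurableT_comp => //.
  exact: measurable_dot_tuple.
have h0 y : (0 <= h y)%E by rewrite lee_fin expR_ge0.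
apply/esym; apply: (etrans (gamma_tuple_polar b0 bs0 mh h0)).
have mhs : measurable_fun (setT : set (V * U)) (fun p => h (scale_tuple p.1 p.2)).
  by apply: (measurableT_comp mh); exact: measurable_scale_tuple.
apply: (etrans (ge0_integral_swap (gamma_prob sb) (dirichlet_prob b)
  (f := fun s x => h (scale_tuple s x)) mhs (fun _ _ => h0 _))).
have mhx : measurable_fun (setT : set (U * V)) (fun p => h (scale_tuple p.2 p.1)).
  by apply: (measurableT_comp mh); exact: measurable_scale_tuple.
have mI : measurable_fun (setT : set U)
    (fun x => \int[gamma_prob sb]_s h (scale_tuple s x))%E.
  exact: (measurable_fun_ge0_integral (gamma_prob sb)
    (f := fun x s => h (scale_tuple s x)) mhx).
apply: (ge0_eq_integral_dirichlet_prob b0 bs0 mI).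
- by move=> x; exact: integral_ge0.
- apply/measurable_EFinP; apply: (measurableT_comp (measurable_powR (- sb))).
  exact: measurable_dot_tuple.
- by move=> x; rewrite lee_fin powR_ge0.
move=> x xS; rewrite -(gamma_prob_laplace (ltW bs0) (dot_tuple_gt0 f0 xS)).
apply: eq_integral => s _; rewrite /h; congr (expR (- _))%:E.
have x1 : \sum_(i < d.+1) tnth x i = 1 by case: xS.
rewrite -[X in _ - X]x1 mulrC /dot_tuple -sumrB mulr_sumr.
by apply: eq_bigr => i _; rewrite tnth_mktuple; ring.
Qed.

End dirichlet_transform.
(** * The laws of the statement *)

Lemma integral_indicT dd (T : measurableType dd) (R : realType)
    (m : {measure set T -> \bar R}) (A : set T) :
  measurable A -> (\int[m]_x (\1_A x)%:E = m A)%E.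
Proof. by move=> mA; rewrite integral_indic// setIT. Qed.

Section laws_as_measures.
Context {R : realType}.

(** The parameters swap because [complete_coord] puts 1 - x, of exponent q - 1, first. *)
Lemma beta_lawE (p q : R) (A : set R) : 0 < p -> 0 < q -> measurable A ->
  beta_law p q A =
  dirichlet_prob (pair_param q p) [set w : 2.-tuple R | A (tnth w ord_max)].
Proof.
move=> p0 q0 mA; set B := [set w | _].
have mB : measurable B.
  by rewrite -[X in measurable X]setTI; apply: measurable_tnth.
have m1B : measurable_fun setT (fun y => (\1_B y)%:E : \bar R).
  by apply/measurable_EFinP.
have i1B (y : 2.-tuple R) : (0 <= (\1_B y : R)%:E)%E by rewrite lee_fin.
apply: (etrans _ (integral_indicT (dirichlet_prob (pair_param q p)) mB)).
have pp := pair_param_gt0 q0 p0.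
pose H (x : 1.-tuple R) := ((\1_B (complete_coord x))%:E *
  (simplex_pdf (pair_param q p) (complete_coord x))%:E : \bar R)%E.
have mH : measurable_fun setT H.
  apply: emeasurable_funM; first exact: (measurableT_comp m1B (@measurable_complete_coord R 1)).
  apply/measurable_EFinP.
  exact: (measurableT_comp (measurable_simplex_pdf _) (@measurable_complete_coord R 1)).
have H0 x : (0 <= H x)%E by rewrite mule_ge0// lee_fin simplex_pdf_ge0.
apply/esym; apply: (etrans (ge0_integral_dirichlet_prob_pdf pp m1B i1B)).
apply: (etrans (ge0_integral_lebesgue_tupleS mH H0)).
rewrite /beta_law [RHS]integral_mkcond; apply: eq_integral => x _.
apply: (etrans (ge0_integral_lebesgue_tuple0 (measurable_slice x mH))).
have c0 : tnth (complete_coord (cons_pair (x, [tuple]))) ord0 = 1 - x.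
  by rewrite complete_coordE tnth_cons_pair0 sum_cons_pair /sum_tuple big_ord0 addr0.
have c1 : tnth (complete_coord (cons_pair (x, [tuple]))) ord_max = x.
  by rewrite (_ : ord_max = lift ord0 ord0) ?complete_coordE ?tnth_cons_pair_lift
    ?tnth_cons_pair0//; exact: val_inj.
rewrite /H -EFinM indicE patchE.
have -> : (complete_coord (cons_pair (x, [tuple])) \in B) = (x \in A).
  by rewrite -[in RHS]c1.
rewrite in_setI mem_setE in_itv/=.
case: (x \in A); last by rewrite mul0r.
rewrite mul1r /simplex_pdf !big_ord_recl !big_ord0 !addr0 mulr1.
rewrite (_ : lift ord0 ord0 = ord_max); last exact: val_inj.
rewrite c0 c1 /pair_param /= /pos_powR subr_gt0.
case: ifP => x1; last by rewrite !(mulr0, mul0r) andbF.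
case: ifP => x0; last by rewrite !(mulr0, mul0r).
by congr EFin; rewrite [q + p]addrC invfM; ring.
Qed.

Lemma sum_nat_natr d k (b : {ffun 'I_d.+1 -> 'I_k.+1}) :
  (\sum_(i < d.+1) b i == k)%N -> \sum_(i < d.+1) (b i)%:R = k%:R :> R.
Proof. by move=> /eqP bk; rewrite -natr_sum bk. Qed.


Lemma quasi_bernoulliE d k (a : 'I_d.+1 -> R) (A : set (d.+1.-tuple R)) : (0 < k)%N ->
  (forall i, 0 < a i) -> measurable A ->
  (quasi_bernoulli k a A =
   \sum_(b : {ffun 'I_d.+1 -> 'I_k.+1} | (\sum_(i < d.+1) b i == k)%N)
     (bernoulli_weight a b)%:E * dirichlet_prob (fun i => (b i)%:R) A)%E.
Proof.
move=> k0 a0 mA; rewrite /quasi_bernoulli.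
(* Since k > 0, no such [b] is zero, which excludes the junk value of [dirichlet_face]. *)
have faceE (b : {ffun 'I_d.+1 -> 'I_k.+1}) : (\sum_(i < d.+1) b i == k)%N ->
    dirichlet_face (fun i => (b i)%:R) A = dirichlet_prob (fun i => (b i)%:R : R) A.
  by move=> bk; apply: dirichlet_faceE => //; rewrite (sum_nat_natr bk) ltr0n.
rewrite ge0_sume_distrr; last first.
  move=> b bk; rewrite faceE// mule_ge0//.
  by rewrite lee_fin prodr_ge0// => i _; rewrite divr_ge0// ltW// rising_gt0.
by apply: eq_bigr => b bk; rewrite faceE// muleA -EFinM.
Qed.

End laws_as_measures.

(** * Independence as an iterated integral *)

Section independence.
Local Open Scope ereal_scope.

(** Rectangles are stable under intersection and generate the product sigma-algebra. *)
Lemma eq_measure_rectangles d1 d2 (T1 : measurableType d1) (T2 : measurableType d2)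
    (R : realType) (m m' : {measure set (T1 * T2) -> \bar R}) :
  m setT < +oo ->
  (forall A B, measurable A -> measurable B -> m (A `*` B) = m' (A `*` B)) ->
  forall C, measurable C -> m C = m' C.
Proof.
move=> moo mm'.
pose G : set (set (T1 * T2)) :=
  [set C | exists A, measurable A /\ exists B, measurable B /\ C = A `*` B].
move=> C mC; apply: (measure_unique G (fun=> setT)) => //.
- rewrite measurable_prod_measurableType //; congr (<<s _ >>).
  rewrite predeqE; split => [[A mA [B mB <-]]|[A [mA [B [mB ->]]]]].
    by exists A; split => //; exists B.
  by exists A => //; exists B.
- move=> _ _ [A1 [mA1 [A2 [mA2 ->]]]] [B1 [mB1 [B2 [mB2 ->]]]].
  rewrite -setXI; exists (A1 `&` B1); split; first exact: measurableI.
  by exists (A2 `&` B2); split => //; exact: measurableI.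
- by move=> n; exists setT; split => //; exists setT; rewrite setXTT.
- by rewrite bigcup_const.
- by move=> _ [A [mA [B [mB ->]]]]; exact: mm'.
Qed.

Context d0 d1 d2 d3 (Omega : measurableType d0) (V1 : measurableType d1)
  (V2 : measurableType d2) (V3 : measurableType d3) (R : realType) (P : probability Omega R)
  (X1 : {mfun Omega >-> V1}) (X2 : {mfun Omega >-> V2}) (X3 : {mfun Omega >-> V3}).

Hypothesis ind : independent3 P X1 X2 X3.

Let mX12 : measurable_fun setT (fun w => (X1 w, X2 w)).
Proof. by apply/measurable_fun_pair. Qed.

Let X12 : {mfun Omega >-> (V1 * V2)%type} :=
  HB.pack (fun w => (X1 w, X2 w)) (isMeasurableFun.Build _ _ _ _ _ mX12).

Let mX123 : measurable_fun setT (fun w => ((X1 w, X2 w), X3 w)).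
Proof. exact/measurable_fun_pair. Qed.

Let X123 : {mfun Omega >-> ((V1 * V2) * V3)%type} :=
  HB.pack (fun w => ((X1 w, X2 w), X3 w)) (isMeasurableFun.Build _ _ _ _ _ mX123).

Let P1 := distribution P X1.
Let P2 := distribution P X2.
Let P3 := distribution P X3.

(** For fixed [A3] both sides are finite measures in [C], a restriction and a rescaling, that agree
    on rectangles by independence. *)
Let law12 C A3 : measurable C -> measurable A3 ->
  P (X12 @^-1` C `&` X3 @^-1` A3) = (P1 \x P2) C * P3 A3.
Proof.
move=> mC mA3.
have mXA3 : measurable (X3 @^-1` A3) by rewrite -[X in measurable X]setTI; exact: measurable_funP.
pose Q := mrestr P mXA3.
pose c : {nonneg R} := NngNum (fine_ge0 (measure_ge0 P3 A3)).
have cE : c%:num%:E = P3 A3 by rewrite /= fineK// fin_num_measure.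
transitivity (pushforward Q X12 C) => //.
transitivity (mscale c (P1 \x P2)%E C); last by rewrite /mscale/= fineK ?fin_num_measure// muleC.
apply: eq_measure_rectangles => //.
  apply: (@le_lt_trans _ _ 1); last exact: ltry.
  rewrite -[leLHS]/(P (X12 @^-1` setT `&` X3 @^-1` A3)).
  by apply: probability_le1; rewrite preimage_setT setTI.
move=> A B mA mB.
transitivity (P1 A * P2 B * P3 A3); first exact: ind.
rewrite -cE muleC -(product_measure1E P1 P2 mA mB) /mscale.
by [].
Qed.

(** The rectangle argument is used again, on pairs against the third variable, to identify the joint
    law with the product; Tonelli then iterates the integral. *)
Lemma independent3_integral (F : V1 -> V2 -> V3 -> \bar R) :
  measurable_fun setT (fun p : (V1 * V2) * V3 => F p.1.1 p.1.2 p.2) ->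
  (forall x y z, 0 <= F x y z) ->
  \int[P]_w F (X1 w) (X2 w) (X3 w) =
  \int[P1]_x \int[P2]_y \int[P3]_z F x y z.
Proof.
move=> mF F0.
transitivity (\int[distribution P X123]_p F p.1.1 p.1.2 p.2).
  by rewrite ge0_integral_distribution.
transitivity (\int[product_prob P1 P2 \x P3]_p F p.1.1 p.1.2 p.2).
  apply: eq_measure_integral => C mC _; apply: eq_measure_rectangles => //.
    apply: (@le_lt_trans _ _ 1); last exact: ltry.
    exact: (probability_le1 (distribution P X123) measurableT).
  move=> A B mA mB; apply: (etrans (law12 mA mB)).
  exact/esym/(product_measure1E (product_prob P1 P2) P3 mA mB).
have mG : measurable_fun setT (fun p : V1 * V2 => \int[P3]_z F p.1 p.2 z).
  exact: (measurable_fun_ge0_integral P3 (f := fun (p : V1 * V2) z => F p.1 p.2 z) mF).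
rewrite (ge0_integral_prod (product_prob P1 P2) P3
  (f := fun (p : V1 * V2) z => F p.1 p.2 z) mF)//.
rewrite (ge0_integral_prod P1 P2 (f := fun x y => \int[P3]_z F x y z) mG)//.
by move=> x y; exact: integral_ge0.
Qed.

End independence.
(** [quasi_bernoulli] is a bare set function; [m] stands for a measure agreeing with it, such as the
    distribution of B. *)
Lemma ge0_integral_quasi_bernoulli (R : realType) d k (a : 'I_d.+1 -> R)
    (m : {measure set (d.+1.-tuple R) -> \bar R}) (g : d.+1.-tuple R -> \bar R) :
  (0 < k)%N -> (forall i, 0 < a i) ->
  (forall A, measurable A -> m A = quasi_bernoulli k a A) ->
  measurable_fun setT g -> (forall y, (0 <= g y)%E) ->
  (\int[m]_x g x =
   \sum_(b : {ffun 'I_d.+1 -> 'I_k.+1} | (\sum_(i < d.+1) b i == k)%N)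
     (bernoulli_weight a b)%:E * \int[dirichlet_prob (fun i => (b i)%:R)]_x g x)%E.
Proof.
move=> k0 a0 mE mg g0.
(* The multi-indices are enumerated because [msum] adds measures indexed by natural numbers. *)
pose e := [seq b : {ffun 'I_d.+1 -> 'I_k.+1} <- index_enum _ | (\sum_(i < d.+1) b i == k)%N].
pose be := nth [ffun=> ord0] e.
pose w n : {nonneg R} := NngNum (bernoulli_weight_ge0 (be n) a0).
pose D n := dirichlet_prob (fun i => (be n i)%:R : R).
pose m_ n : {measure set (d.+1.-tuple R) -> \bar R} := mscale (w n) (D n).
have sumE (F : {ffun 'I_d.+1 -> 'I_k.+1} -> \bar R) :
    (\sum_(b : {ffun 'I_d.+1 -> 'I_k.+1} | (\sum_(i < d.+1) b i == k)%N) F b =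
     \sum_(n < size e) F (be n))%E.
  by rewrite -big_filter (big_nth [ffun=> ord0]) big_mkord.
rewrite sumE; transitivity (\int[msum m_ (size e)]_x g x)%E.
  apply: eq_measure_integral => A mA _.
  by rewrite mE// quasi_bernoulliE// sumE.
rewrite ge0_integral_measure_sum//; apply: eq_bigr => n _.
exact: (ge0_integral_mscale (D n) measurableT (w n) mg (fun y _ => g0 y)).
Qed.

(** * The two claims *)

Theorem theorem4p1 (R : realType) (d k : nat) (a : 'I_d.+1 -> R)
    (hd : (0 < d)%N) (hk : (0 < k)%N) (ha : forall i, 0 < a i)
    (disp : measure_display) (Omega : measurableType disp)
    (P : probability Omega R)
    (X B : {RV P >-> (d.+1.-tuple R)%type})
    (XE : forall w, simplex (X w)) (BE : forall w, simplex (B w))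
    (hX : has_law P X (dirichlet a))
    (hB : has_law P B (quasi_bernoulli k a)) :
  let asum := \sum_(i < d.+1) a i in
  (forall f : 'I_d.+1 -> R, (forall i, 0 < f i) ->
     (T_ P k%:R B f = T_ P (asum + k%:R) X f / T_ P asum X f)%E) /\
  (forall Y : {RV P >-> R},
     has_law P Y (beta_law k%:R asum) ->
     independent3 P X B Y ->
     eq_in_law P X (fun w => mix (Y w) (X w) (B w))).
Proof.
move=> asum.
have as0 : 0 < asum by exact: sum_gt0.
have a0 i : 0 <= a i by exact: ltW.
have lawX g : measurable_fun setT g -> (forall y, (0 <= g y)%E) ->
    (\int[distribution P X]_x g x = \int[dirichlet_prob a]_x g x)%E.
  move=> mg g0; apply: eq_measure_integral => A mA _.
  exact: (etrans (hX A mA) (dirichletE ha mA)).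
have lawB g : measurable_fun setT g -> (forall y, (0 <= g y)%E) ->
    (\int[distribution P B]_x g x =
     \sum_(b : {ffun 'I_d.+1 -> 'I_k.+1} | (\sum_(i < d.+1) b i == k)%N)
     (bernoulli_weight a b)%:E * \int[dirichlet_prob (fun i => (b i)%:R)]_x g x)%E.
  by move=> mg g0; exact: ge0_integral_quasi_bernoulli.
have bs (b : {ffun 'I_d.+1 -> 'I_k.+1}) : (\sum_(i < d.+1) b i == k)%N ->
    0 < \sum_(i < d.+1) (b i)%:R :> R.
  by move=> bk; rewrite (sum_nat_natr bk) ltr0n.
split=> [f f0|Y hY ind].
  have mdot c : measurable_fun setT
      (fun x : d.+1.-tuple R => (dot_tuple f x `^ c)%:E).
    apply/measurable_EFinP; apply: (measurableT_comp (measurable_powR c)).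
    exact: measurable_dot_tuple.
  have dot0 c x : (0 <= (dot_tuple f x `^ c)%:E)%E by rewrite lee_fin powR_ge0.
  have TE c (Z : {RV P >-> (d.+1.-tuple R)%type}) :
      T_ P c Z f = (\int[distribution P Z]_x (dot_tuple f x `^ (- c))%:E)%E.
    by rewrite /T_ unlock ge0_integral_distribution.
  have TX : T_ P asum X f = (\prod_(i < d.+1) f i `^ (- a i))%:E.
    rewrite TE lawX//; exact: dirichlet_prob_transform.
  have TB : T_ P k%:R B f = (\sum_(b : {ffun 'I_d.+1 -> 'I_k.+1} |
      (\sum_(i < d.+1) b i == k)%N)
      bernoulli_weight a b * \prod_(i < d.+1) f i `^ (- (b i)%:R))%:E.
    rewrite TE lawB// -sumEFin; apply: eq_bigr => b bk.
    rewrite [RHS]EFinM; congr (_ * _)%E; rewrite -(sum_nat_natr bk).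
    by apply: dirichlet_prob_transform => //; exact: bs.
  (* Expanding D(a) into the D(a + b) gives every term total parameter [asum + k], the exponent at
     which its transform is a product. *)
  have TXk : T_ P (asum + k%:R) X f = (\sum_(b : {ffun 'I_d.+1 -> 'I_k.+1} |
      (\sum_(i < d.+1) b i == k)%N)
      bernoulli_weight a b * \prod_(i < d.+1) f i `^ (- (a i + (b i)%:R)))%:E.
    rewrite TE lawX// -(dirichlet_prob_mixture k ha (mdot _) (dot0 _)) -sumEFin.
    apply: eq_bigr => b bk; rewrite [RHS]EFinM; congr (_ * _)%E.
    rewrite /asum -(sum_nat_natr bk) -big_split/=.
    apply: dirichlet_prob_transform => //.
    - by move=> i; rewrite addr_ge0.
    - by rewrite big_split/= addr_gt0// bs.
  (* With a finite nonzero denominator, the extended quotient is the real one. *)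
  have fa0 : \prod_(i < d.+1) f i `^ (- a i) != 0.
    by rewrite gt_eqF// prodr_gt0// => i _; exact: powR_gt0.
  rewrite TX TXk TB inver (negbTE fa0) -EFinM; congr EFin.
  rewrite mulr_suml; apply: eq_bigr => b bk.
  have -> : \prod_(i < d.+1) f i `^ (- (a i + (b i)%:R)) =
      \prod_(i < d.+1) f i `^ (- a i) * \prod_(i < d.+1) f i `^ (- (b i)%:R).
    rewrite -big_split/=; apply: eq_bigr => i _.
    by rewrite opprD powRD// (gt_eqF (f0 i)) implybT.
  by field.
move=> A mA.
pose U := d.+1.-tuple R.
pose g (x : U) : \bar R := (\1_A x)%:E.
have mg : measurable_fun setT g by apply/measurable_EFinP.
have g0 x : (0 <= g x)%E by rewrite lee_fin.
pose F (x b : U) (y : R) := g (mix y x b).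
have F0 x b y : (0 <= F x b y)%E by exact: g0.
have mF : measurable_fun setT (fun p : (U * U) * R => F p.1.1 p.1.2 p.2).
  apply: (measurableT_comp mg); apply: measurable_mix => //; exact: measurableT_comp.
have k0 : 0 < k%:R :> R by rewrite ltr0n.
pose pw := dirichlet_prob (pair_param asum k%:R).
have lawY h : measurable_fun setT h -> (forall y, (0 <= h y)%E) ->
    (\int[distribution P Y]_y h y = \int[pw]_w h (tnth w ord_max))%E.
  move=> mh h0.
  have mt : measurable_fun setT (fun w : 2.-tuple R => tnth w ord_max).
    exact: measurable_tnth.
  transitivity (\int[pushforward pw (fun w : 2.-tuple R => tnth w ord_max)]_y h y)%E.
    apply: eq_measure_integral => C mC _.
    by apply: (etrans (hY C mC)); exact: beta_lawE.
  exact: (ge0_integral_pushforward mt pw measurableT mh (fun y _ => h0 y)).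
apply/esym.
have mmix : measurable_fun setT (fun w => mix (Y w) (X w) (B w)).
  by apply: measurable_mix; exact: measurable_funP.
transitivity (\int[P]_w F (X w) (B w) (Y w))%E.
  have mAm : measurable ((fun w => mix (Y w) (X w) (B w)) @^-1` A).
    by rewrite -[X in measurable X]setTI; exact: mmix.
  by rewrite -(integral_indicT P mAm).
apply: (etrans (independent3_integral ind mF F0)).
transitivity (\int[dirichlet_prob a]_x g x)%E; last first.
  by rewrite -(lawX g mg g0); exact: integral_indicT.
have mFy (x b : U) : measurable_fun setT (F x b).
  exact: (measurableT_comp mF (measurable_pair1 (x, b))).
(* Y is integrated out innermost, through its realization as a Dirichlet coordinate. *)
pose L x b := (\int[pw]_w F x b (tnth w ord_max))%E.
have L0 x b : (0 <= L x b)%E by exact: integral_ge0.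
have mL : measurable_fun setT (fun p : U * U => L p.1 p.2).
  apply: (measurable_fun_ge0_integral pw
    (f := fun (p : U * U) (w : 2.-tuple R) => F p.1 p.2 (tnth w ord_max))) => //.
  apply: (measurableT_comp mF (g := fun p => (p.1, tnth p.2 ord_max))).
  apply/measurable_fun_pair => //=.
  exact: (measurable_fun_tnth ord_max (f := snd)).
have mLx x : measurable_fun setT (L x).
  exact: (measurableT_comp mL (measurable_pair1 x)).
have mLI (Q : probability U R) : measurable_fun setT (fun x => \int[Q]_b L x b)%E.
  exact: (measurable_fun_ge0_integral Q (f := L) mL).
transitivity (\int[distribution P X]_x \int[distribution P B]_b L x b)%E.
  apply: eq_integral => x _; apply: eq_integral => b _.
  exact: (lawY _ (mFy x b) (F0 x b)).
have LI0 (Q : probability U R) x : (0 <= \int[Q]_b L x b)%E by exact: integral_ge0.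
apply: (etrans (lawX _ (mLI (distribution P B)) (LI0 _))).
pose J (b : {ffun 'I_d.+1 -> 'I_k.+1}) (x : U) :=
  ((bernoulli_weight a b)%:E *
   \int[dirichlet_prob (fun i => (b i)%:R : R)]_z L x z)%E.
have w0 b : (0 <= (bernoulli_weight (k := k) a b)%:E)%E.
  by rewrite lee_fin bernoulli_weight_ge0.
have mJ b : measurable_fun setT (J b).
  by apply: emeasurable_funM; [exact: measurable_cst|exact: mLI].
have J0 b x : (0 <= J b x)%E by exact: mule_ge0.
transitivity (\int[dirichlet_prob a]_x
    \sum_(b <- [seq b : {ffun 'I_d.+1 -> 'I_k.+1} <- index_enum _ |
       (\sum_(i < d.+1) b i == k)%N]) J b x)%E.
  by apply: eq_integral => x _; rewrite big_filter; exact: (lawB _ (mLx x) (L0 x)).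
apply: (etrans (ge0_integral_sum (dirichlet_prob a) measurableT mJ (fun b x _ => J0 b x) _)).
rewrite big_filter; apply: (etrans _ (dirichlet_prob_mixture k ha mg g0)).
apply: eq_bigr => b bk.
apply: (etrans (ge0_integralZl (dirichlet_prob a) measurableT
  (mLI (dirichlet_prob (fun i => (b i)%:R : R))) (fun x _ => LI0 _ x) (w0 b))).
have b0 i : 0 <= (b i)%:R :> R by [].
(* The weight variable here has law beta(|b|, asum) with |b| = k, which is the law of Y for every
   [b]. *)
have := dirichlet_prob_mix a0 as0 b0 (bs b bk) mg g0.
rewrite (sum_nat_natr bk) => mixE_b.
exact: (congr1 (fun u => (bernoulli_weight a b)%:E * u)%E mixE_b).
Qed.
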